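(* Let $\nu, m_1, m_2, t$ be positive integers with $m_1\ge m_2\ge t+1$ and $2\nu\ge 2m_1+m_2+t+3$. Suppose $\mathcal F_1\subseteq\mathcal P_{m_1}$ and $\mathcal F_2\subseteq\mathcal P_{m_2}$ are non-trivial cross $t$-intersecting families such that $|\mathcal F_1|\cdot|\mathcal F_2|$ is maximum among all pairs of non-trivial cross $t$-intersecting families $\mathcal F_1\subseteq\mathcal P_{m_1}$, $\mathcal F_2\subseteq\mathcal P_{m_2}$. (i) If $m_2>2t$ or $(m_1,m_2,t)\in\{(2,2,1),(3,2,1)\}$, then there exist $M\in\mathcal P_{m_2+1}$ and a $t$-dimensional subspace $T\subseteq M$ such that either $\mathcal F_1=\mathcal C_1(M,T;m_1,t)$ and $\mathcal F_2=\mathcal C_2(M,T;m_2)$; or $m_1=m_2$ and $\mathcal F_1=\mathcal C_2(M,T;m_1)$, $\mathcal F_2=\mathcal C_1(M,T;m_2,t)$. (ii) If $m_2\le 2t$ and $(m_1,m_2,t)\notin\{(2,2,1),(3,2,1)\}$, then there exists $S\in\mathcal P_{t+1}$ such that either $\mathcal F_1=\mathcal C_3(S;m_1)$ and $\mathcal F_2=\mathcal C_4(S;m_2,t)$; or $m_1=m_2$ and $\mathcal F_1=\mathcal C_4(S;m_1,t)$, $\mathcal F_2=\mathcal C_3(S;m_2)$.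
   Context: Let $q$ be a prime power, $\nu\ge 1$ an integer, and $f$ a non-degenerate alternating bilinear form on $V=\mathbb F_q^{2\nu}$. A subspace $W\le V$ is totally isotropic if $f(x,y)=0$ for all $x,y\in W$ (maximal totally isotropic subspaces have dimension $\nu$). For $0\le m\le \nu$, $\mathcal P_m$ denotes the set of all $m$-dimensional totally isotropic subspaces of $V$. For a subspace $A$ and integer $k$, ${A\brack k}$ denotes the set of $k$-dimensional subspaces of $A$. Families $\mathcal F_1\subseteq\mathcal P_{m_1}$ and $\mathcal F_2\subseteq\mathcal P_{m_2}$ are called cross $t$-intersecting if $\dim(F_1\cap F_2)\ge t$ for all $F_1\in\mathcal F_1$, $F_2\in\mathcal F_2$; they are trivial if some $t$-dimensional totally isotropic subspace is contained in every member of $\mathcal F_1\cup\mathcal F_2$, and non-trivial otherwise. For $M\in\mathcal P_{m+1}$ (where $m$ is the relevant dimension), a $t$-dimensional subspace $T\subseteq M$, $S\in\mathcal P_{t+1}$, and integers $a,b$: $\mathcal C_1(M,T;a,t)=\{F\in\mathcal P_{a}: T\subseteq F,\ \dim(F\cap M)\ge t+1\}$; $\mathcal C_2(M,T;b)=\{F\in\mathcal P_{b}: T\subseteq F\}\cup{M\brack b}$ (here $\dim M=b+1$); $\mathcal C_3(S;a)=\{F\in\mathcal P_{a}: S\subseteq F\}$; $\mathcal C_4(S;b,t)=\{F\in\mathcal P_{b}: \dim(F\cap S)\ge t\}$. In (i), first alternative, $M\in\mathcal P_{m_2+1}$ is used for both families; in the second alternative ($m_1=m_2$), also $M\in\mathcal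 P_{m_2+1}=\mathcal P_{m_1+1}$. *)

(* Defs.v *)
(* Subspaces of V = F^(2 nu) are represented canonically by
   square matrices A with <<A>>%MS = A (row space); dim = \rank A. *)
From HB Require Import structures.
From mathcomp Require Import all_boot all_order all_algebra.
Set Implicit Arguments. Unset Strict Implicit. Unset Printing Implicit Defensive.
Import GRing.Theory.
Local Open Scope ring_scope.

Section Symplectic.
Variables (F : finFieldType) (nu : nat).
Local Notation n := (2 * nu)%N.
Local Notation vec := 'rV[F]_n.
Local Notation sub := 'M[F]_n.

Definition bform (J : sub) (x y : vec) : F := (x *m J *m y^T) 0 0.

Definition nondeg_alt (J : sub) : Prop :=
  J \in unitmx /\ forall x : vec, bform J x x = 0.

Definition is_subspace (A : sub) : bool := (<<A>>%MS == A).

Definition tot_iso (J : sub) (A : sub) : bool :=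
  [forall x : vec, forall y : vec,
     ((x <= A)%MS && (y <= A)%MS) ==> (bform J x y == 0)].

Definition Pm (J : sub) (m : nat) : {set sub} :=
  [set A : sub | [&& is_subspace A, \rank A == m & tot_iso J A]].

Definition subs_of (A : sub) (k : nat) : {set sub} :=
  [set B : sub | [&& is_subspace B, \rank B == k & (B <= A)%MS]].

Definition cross_int (t : nat) (F1 F2 : {set sub}) : Prop :=
  forall A B, A \in F1 -> B \in F2 -> (t <= \rank (A :&: B)%MS)%N.

Definition trivial_fam (J : sub) (t : nat) (F1 F2 : {set sub}) : Prop :=
  exists2 T, T \in Pm J t & forall A, A \in F1 :|: F2 -> (T <= A)%MS.

Definition C1 (J M T : sub) (a t : nat) : {set sub} :=
  [set A in Pm J a | (T <= A)%MS && (t.+1 <= \rank (A :&: M)%MS)%N].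

Definition C2 (J M T : sub) (b : nat) : {set sub} :=
  [set A in Pm J b | (T <= A)%MS] :|: subs_of M b.

Definition C3 (J S : sub) (a : nat) : {set sub} :=
  [set A in Pm J a | (S <= A)%MS].

Definition C4 (J S : sub) (b t : nat) : {set sub} :=
  [set A in Pm J b | (t <= \rank (A :&: S)%MS)%N].

End Symplectic.

(* Main.v *)
(* With [d] = (q^d - 1)/(q - 1), let N(s, m) be the number of totally isotropic
   m-spaces above an isotropic s-space: N(s, m) [m - s] = [2 nu - 2 s] N(s + 1, m).
   If S meets some G in F2 in dimension < t, every member of F1 above S contains
   one of [m2 - t + 1] extensions of S by one dimension, which bounds F1 and F2
   through isotropic covers (subspaces meeting all of the other family in
   dimension >= t).  The yardstick is
     D = [m2 - t] N(t, m2) N(t + 1, m1) = [2 nu - 2 t] N(t + 1, m1) N(t + 1, m2),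
   which is symmetric in the two families.  If neither family has a common
   t-space, |F1| |F2| <= D.  If all of F1 contains T but F2 does not, let M be the
   span of the (t+1)-dimensional isotropic covers of F2 above T; members of F2
   not above T meet M in a hyperplane of M.  Then dim M = m2 + 1 forces the pair
   (C1, C2), dim M = t + 1 forces (C3, C4) or a small product, and in all other
   cases |F1| |F2| <= 3/2 D.  Since |C1| |C2| > 3/2 D, only the structured pairs
   remain, and these are compared by (nearly) exact counts. *)

Require Import Defs.
From mathcomp Require Import all_boot all_order all_algebra.
From mathcomp Require Import mxabelem.
From mathcomp Require Import zify ring lra.
Set Implicit Arguments. Unset Strict Implicit. Unset Printing Implicit Defensive.
Import Order.TTheory GRing.Theory Num.Theory.
Local Open Scope ring_scope.

(** The factor 3/2 is room between two estimates. With a common [T] and no structured pair, the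
    families exceed their main terms [[m2 - t] N(t + 1, m1)] and [N(t, m2)] by factors at most 5/4
    and 9/8, and 5/4 * 9/8 = 45/32; the pair ([C1], [C2]) exceeds 7/4 D because [[m2 + 1 - t] >= 2
    [m2 - t] + 1]. The obstacle is the comparison of the structured pairs, where leading terms tie
    twice. The products for ([C1], [C2]) and ([C3], [C4]) have leading factors [[m2 + 1 - t]] and
    [[t + 1]], equal when [m2 = 2 t]; second-order terms then decide, and for [t = 1] even these are
    close enough that the answer changes between [m1 = 3] and [m1 = 4]. For [m1 > m2] the pair
    ([C1], [C2]) with exchanged roles agrees with the original one up to the lower-order [1] in
    [[d + 1] = q [d] + 1]. Products of brackets are bounded through [[x] [y] <= [x + y]] and [2 ^ d
    [x] <= [x + d]], so the hypothesis on [nu] enters as a linear inequality between indices. *)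

Definition qint (q n : nat) : rat := \sum_(i < n) q%:R ^+ i.

(** * Inequalities between q-brackets *)

Section QInt.
Variable q : nat.
Hypothesis q_gt1 : (1 < q)%N.
Local Notation br := (qint q).

Lemma qR_ge2 : 2 <= q%:R :> rat.
Proof. by rewrite (ler_nat _ 2). Qed.

Lemma qint0 : br 0 = 0.
Proof. exact: big_ord0. Qed.

Lemma qintS n : br n.+1 = q%:R * br n + 1.
Proof.
rewrite /qint big_ord_recl expr0 addrC mulr_sumr; congr (_ + _).
by apply: eq_bigr => i _; rewrite -exprS.
Qed.

Lemma qint1 : br 1 = 1.
Proof. by rewrite qintS qint0 mulr0 add0r. Qed.

Lemma qint2 : br 2 = q%:R + 1.
Proof. by rewrite qintS qint1 mulr1. Qed.

Lemma qintD x y : br (x + y) = br x + q%:R ^+ x * br y.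
Proof.
elim: x => [|x IH]; first by rewrite qint0 expr0 mul1r add0r.
by rewrite addSn !qintS IH exprS; ring.
Qed.

Lemma qintE n : (q%:R - 1) * br n = q%:R ^+ n - 1.
Proof.
elim: n => [|n IH]; first by rewrite qint0 expr0 mulr0 subrr.
by rewrite qintS exprS mulrDr mulrCA IH; ring.
Qed.

Lemma qint_ge0 n : 0 <= br n.
Proof. by apply: sumr_ge0 => i _; rewrite exprn_ge0. Qed.

Lemma qint_gt0 n : (0 < n)%N -> 0 < br n.
Proof.
by case: n => // n _; rewrite qintS; have := qint_ge0 n; have := qR_ge2; nra.
Qed.

Lemma qint_ge1 n : (0 < n)%N -> 1 <= br n.
Proof.
by case: n => // n _; rewrite qintS; have := qint_ge0 n; have := qR_ge2; nra.
Qed.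

Lemma le_qint : {homo br : x y / (x <= y)%N >-> x <= y}.
Proof.
move=> x y /subnK <-; rewrite addnC qintD lerDl mulr_ge0 ?qint_ge0 //.
by rewrite exprn_ge0.
Qed.

Lemma qint_expr x : q%:R ^+ x <= br x.+1.
Proof. by rewrite -addn1 qintD qint1 mulr1 lerDr qint_ge0. Qed.

Lemma qint_double x : 2 * br x <= br x.+1.
Proof. by rewrite qintS; have := qint_ge0 x; have := qR_ge2; nra. Qed.

Lemma qintM x y : br x * br y <= br (x + y).
Proof.
have -> : br (x + y) = br x + ((q%:R - 1) * br x + 1) * br y.
  by rewrite qintD qintE subrK.
have hx := qint_ge0 x; have hy := qint_ge0 y; have hxy := mulr_ge0 hx hy.
by have := qR_ge2; nra.
Qed.

(** The converse of [qintM] at the price of one index: it bounds the ratio [br (t + s).+1 / br s.+1]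
    of consecutive Gaussian coefficients by [br t.+1]. *)
Lemma qintMS x y : br (x + y).+1 <= br x.+1 * br y.+1.
Proof.
rewrite -addSn qintD [br y.+1]qintS exprS mulrDr mulr1 addrC lerD2r.
rewrite mulrA [br x.+1 * _]mulrC ler_wpM2r ?qint_ge0 //.
by rewrite ler_wpM2l ?qint_expr.
Qed.

Lemma qint_pow2 d x : 2 ^+ d * br x <= br (x + d).
Proof.
elim: d => [|d IH]; first by rewrite expr0 mul1r addn0.
rewrite addnS exprS -mulrA; apply: le_trans (qint_double _).
by rewrite ler_pM2l.
Qed.

End QInt.

Lemma double_count (T1 T2 : finType) (X : {set T1}) (Y : {set T2})
    (r : T1 -> T2 -> bool) :
  (\sum_(a in X) #|[set b in Y | r a b]|
   = \sum_(b in Y) #|[set a in X | r a b]|)%N.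
Proof.
under eq_bigr do rewrite -sum1_card.
under [RHS]eq_bigr do rewrite -sum1_card.
rewrite (exchange_big_dep (mem Y)) /=; last first.
  by move=> a b _; rewrite inE => /andP[].
by apply: eq_bigr => b bY; apply: eq_bigl => a; rewrite !inE bY.
Qed.

(** * Counting chains of subspaces *)

Section Subspaces.
Variables (F : finFieldType) (nu : nat).
Local Notation n := (2 * nu)%N.
Local Notation sub := 'M[F]_n.
Local Notation q := #|F|.
Local Notation br := (qint #|F|).

Lemma card_F_gt1 : (1 < q)%N.
Proof. exact: finalg.card_finNzRing_gt1. Qed.

Lemma genmx_subspace m (A : 'M[F]_(m, n)) : is_subspace <<A>>%MS.
Proof. by rewrite /is_subspace genmx_id. Qed.

Lemma subspace_eq (A B : sub) : is_subspace A -> is_subspace B ->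
  (A <= B)%MS -> (\rank B <= \rank A)%N -> A = B.
Proof.
move=> /eqP hA /eqP hB sAB rBA; rewrite -hA -hB; apply/genmxP.
rewrite sAB /=; have [le <-] := mxrank_leqif_sup sAB.
by rewrite eqn_leq le.
Qed.

Lemma rank_adds_row m (R : 'M[F]_(m, n)) (v : 'rV[F]_n) : ~~ (v <= R)%MS ->
  \rank (R + v)%MS = (\rank R).+1.
Proof.
move=> nvR; have := mxrank_sum_cap R v.
have v0 : v != 0 by apply: contra nvR => /eqP ->; exact: sub0mx.
rewrite (rank_rV v) v0.
have -> : \rank (R :&: v)%MS = 0%N; last by rewrite addn0 addn1.
apply/eqP; rewrite -leqn0 leqNgt; apply: contra nvR => h.
have /mxrank_leqif_sup [_] := capmxSr R v.
have := mxrankS (capmxSr R v); rewrite (rank_rV v) v0 => h1.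
by rewrite eqn_leq h1 h => /esym; rewrite sub_capmx => /andP[].
Qed.

Lemma card_row_sub (A : sub) :
  #|[set v : 'rV[F]_n | (v <= A)%MS]| = (q ^ \rank A)%N.
Proof.
exact: card_rowg.
Qed.

Lemma card_row_diff (R A : sub) : (R <= A)%MS ->
  #|[set v : 'rV[F]_n | (v <= A)%MS & ~~ (v <= R)%MS]|%:R
  = q%:R ^+ \rank A - q%:R ^+ \rank R :> rat.
Proof.
move=> sRA; rewrite -!natrX -!card_row_sub.
rewrite -(cardsID [set v : 'rV[F]_n | (v <= R)%MS] [set v : 'rV[F]_n | (v <= A)%MS]).
rewrite natrD.
have -> : [set v : 'rV[F]_n | (v <= A)%MS] :&: [set v : 'rV[F]_n | (v <= R)%MS]
   = [set v : 'rV[F]_n | (v <= R)%MS].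
  apply/setP=> v; rewrite !inE andbC; case vR: (v <= R)%MS => //=.
  exact: submx_trans sRA.
rewrite [X in _ = X - _]addrC addrK; congr (_ %:R); apply: eq_card => v.
by rewrite !inE andbC.
Qed.

Definition ext (R E : sub) : {set sub} :=
  [set A | [&& is_subspace A, \rank A == (\rank R).+1, (R <= A)%MS
             & (A <= E)%MS]].

Lemma ext_mem (R E : sub) (v : 'rV[F]_n) :
  (R <= E)%MS -> (v <= E)%MS -> ~~ (v <= R)%MS -> <<(R + v)%MS>>%MS \in ext R E.
Proof.
move=> sRE sv nv; rewrite inE genmx_subspace !genmxE rank_adds_row // eqxx /=.
by rewrite addsmxSl addsmx_sub sRE.
Qed.

(** Count the vectors of [E] outside [R]: each spans with [R] exactly one extension, and an
    extension contains [q ^ (r + 1) - q ^ r] of them, where [r = \rank R]. *)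
Lemma card_ext (R E : sub) : (R <= E)%MS ->
  #|ext R E|%:R = br (\rank E - \rank R) :> rat.
Proof.
move=> sRE; have q2 := qR_ge2 card_F_gt1.
have qs : 0 < (q%:R : rat) ^+ \rank R by rewrite exprn_gt0 //; lra.
have q1 : (q%:R - 1 : rat) != 0 by lra.
pose W := [set v : 'rV[F]_n | (v <= E)%MS & ~~ (v <= R)%MS].
have H1 : (\sum_(v in W) #|[set A in ext R E | (v <= A)%MS]| = #|W|)%N.
  rewrite -sum1_card; apply: eq_bigr => v; rewrite inE => /andP[vE vR].
  apply/eqP/cards1P; exists <<(R + v)%MS>>%MS; apply/setP => A; rewrite in_set1 inE.
  apply/andP/eqP => [[]|->]; last first.
    by rewrite ext_mem // genmxE addsmxSr.
  rewrite inE => /and4P[hA /eqP rA sRA sAE] vA.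
  apply/esym/subspace_eq; rewrite ?genmx_subspace ?genmxE //.
    by rewrite addsmx_sub sRA.
  by rewrite rank_adds_row // rA.
move: H1; rewrite double_count => /(congr1 (fun x => x%:R : rat)).
rewrite natr_sum (eq_bigr (fun=> q%:R ^+ \rank R * (q%:R - 1))).
  rewrite sumr_const -[_ *+ #|_|]mulr_natr card_row_diff //.
  rewrite -{1}(subnK (mxrankS sRE)) addnC exprD.
  set e := (\rank E - _)%N; move=> H; have := qintE q e => He.
  apply: (mulfI (lt0r_neq0 qs)); apply: (mulfI q1).
  by rewrite [RHS]mulrCA He mulrA [(_ - 1) * _]mulrC; move: H; lra.
move=> A; rewrite inE => /and4P[hA /eqP rA sRA sAE].
have -> : [set v in W | (v <= A)%MS] =
          [set v : 'rV[F]_n | (v <= A)%MS & ~~ (v <= R)%MS].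
  apply/setP => v; rewrite !inE; case vA: (v <= A)%MS; rewrite ?andbF //=.
  by rewrite (submx_trans vA sAE) andbT.
by rewrite card_row_diff // rA exprS; ring.
Qed.

Lemma ext_neq0 (R E : sub) : (R <= E)%MS -> (\rank R < \rank E)%N ->
  exists A, A \in ext R E.
Proof.
move=> sRE lt; apply/set0Pn; rewrite -card_gt0 -(ltr_nat rat) card_ext //.
by rewrite qint_gt0 ?card_F_gt1 ?subn_gt0.
Qed.

(* The number of members of rank [m] above a given one of rank [s], in a
   hereditary family where every member of rank [i] lies in exactly [e i]
   members of rank [i + 1]; double counting flags gives the factors. *)
Definition chain_num (e : nat -> rat) (s m : nat) : rat :=
  if (s <= m)%N then \prod_(s <= i < m) (e i / br (m - i)) else 0.

(** The default value 0 for [m < s] makes the recursion valid for all [s]: at [s = m] both sides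
    vanish because [br 0 = 0]. *)
Lemma chain_numS e s m : e s != 0 ->
  chain_num e s m * br (m - s) = e s * chain_num e s.+1 m.
Proof.
rewrite /chain_num => e0; have [lt|lt|->] := ltngtP s m.
- rewrite big_ltn // mulrAC -!mulrA; congr (_ * _).
  by rewrite mulKf // gt_eqF // qint_gt0 ?card_F_gt1 ?subn_gt0.
- by rewrite mul0r mulr0.
- by rewrite subnn qint0 !mulr0.
Qed.

Lemma chain_num_id e m : chain_num e m m = 1.
Proof. by rewrite /chain_num leqnn big_geq. Qed.

Lemma chain_num_ge0 e s m : (forall i, 0 <= e i) -> 0 <= chain_num e s m.
Proof.
move=> e0; rewrite /chain_num; case: ifP => // _; apply: prodr_ge0 => i _.
by rewrite divr_ge0 ?qint_ge0.
Qed.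

Lemma chain_num_gt0 e s m : (s <= m)%N ->
  (forall i, (i < m)%N -> 0 < e i) -> 0 < chain_num e s m.
Proof.
move=> le e0; rewrite /chain_num le big_nat_cond; apply: prodr_gt0 => i.
by case/andP=> /andP[_ hi] _; rewrite divr_gt0 ?e0 ?qint_gt0 ?card_F_gt1 ?subn_gt0.
Qed.

(** Induction on [m - \rank R], counting pairs [B <= A] where [B] is a good extension of [R]. By
    heredity every extension of [R] inside [A] is good, which gives [br (m - \rank R)] choices of
    [B] for each [A]. The two uses take good to mean contained in a fixed [E], or totally
    isotropic. *)
Lemma card_chain (good : pred sub) (e : nat -> rat) (m : nat) :
  (forall A B, good B -> (A <= B)%MS -> good A) ->
  (forall R, is_subspace R -> good R -> (\rank R < m)%N ->
     #|[set A in ext R 1%:M | good A]|%:R = e (\rank R)) ->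
  forall R, is_subspace R -> good R ->
  #|[set A | [&& is_subspace A, \rank A == m, good A & (R <= A)%MS]]|%:R
  = chain_num e (\rank R) m.
Proof.
move=> her hext R sR gR; move: {2}(m - _)%N (leqnn (m - \rank R)) => d.
elim: d R sR gR => [|d IH] R sR gR hd.
  rewrite leqn0 subn_eq0 in hd; rewrite /chain_num.
  have [lt|gt|eqm] := ltngtP (\rank R) m; first lia.
    have -> : [set A | [&& is_subspace A, \rank A == m, good A & (R <= A)%MS]]
       = set0; last by rewrite cards0.
    apply/setP=> A; rewrite !inE; apply/negP => /and4P[_ /eqP rA _ /mxrankS].
    lia.
  have -> : [set A | [&& is_subspace A, \rank A == m, good A & (R <= A)%MS]]
       = [set R]; last by rewrite cards1 eqm big_geq.
  apply/setP=> A; rewrite !inE; apply/and4P/eqP => [[sA /eqP rA _ sRA]|->].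
    by apply/esym/subspace_eq => //; lia.
  by rewrite sR eqm eqxx gR submx_refl.
have [lt|ge] := ltnP (\rank R) m; last by apply: IH => //; lia.
set X := [set A | _].
have := double_count X [set A in ext R 1%:M | good A] (fun A B => (B <= A)%MS).
move/(congr1 (fun x => x%:R : rat)); rewrite !natr_sum.
rewrite (eq_bigr (fun=> br (m - \rank R))); last first.
  move=> A; rewrite inE => /and4P[sA /eqP rA gA sRA].
  rewrite -rA -card_ext //; congr (_ %:R); apply: eq_card => B.
  rewrite !inE submx1 andbT; case BA: (B <= A)%MS; rewrite ?andbF //= ?andbT.
  by rewrite (her _ _ gA BA) andbT.
rewrite [X in _ = X](eq_bigr (fun=> chain_num e (\rank R).+1 m)); last first.
  move=> B; rewrite inE => /andP[]; rewrite inE => /and4P[sB /eqP rB sRB _] gB.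
  rewrite -rB -IH //; last by lia.
  congr (_ %:R); apply: eq_card => A; rewrite !inE -!andbA.
  case BA: (B <= A)%MS; rewrite ?andbF //= ?andbT.
  by rewrite (submx_trans sRB BA) andbT.
have b0 : br (m - \rank R) != 0 by rewrite gt_eqF // qint_gt0 ?card_F_gt1 ?subn_gt0.
rewrite !sumr_const -[br _ *+ _]mulr_natl -[chain_num _ _ _ *+ _]mulr_natl.
rewrite hext // => H; apply: (mulIf b0); rewrite H.
have [e0|/chain_numS -> //] := eqVneq (e (\rank R)) 0.
by rewrite e0 mul0r /chain_num ltnW // big_ltn // e0 !mul0r.
Qed.

End Subspaces.

Section SubspaceCounts.
Variables (F : finFieldType) (nu : nat).
Local Notation n := (2 * nu)%N.
Local Notation sub := 'M[F]_n.
Local Notation q := #|F|.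
Local Notation br := (qint #|F|).
Let q1 := card_F_gt1 F.

Lemma card_subs_above (E R : sub) (m : nat) : (R <= E)%MS ->
  #|[set A in subs_of E m | (R <= A)%MS]|%:R
  = chain_num F (fun i => br (\rank E - i)) (\rank R) m.
Proof.
move=> sRE.
have her (A B : sub) : (B <= E)%MS -> (A <= B)%MS -> (A <= E)%MS.
  by move=> BE AB; apply: submx_trans BE.
have hext (S : sub) : is_subspace S -> (S <= E)%MS -> (\rank S < m)%N ->
    #|[set A in ext S 1%:M | (A <= E)%MS]|%:R = br (\rank E - \rank S).
  move=> _ SE _; rewrite -card_ext //; congr (_ %:R); apply: eq_card => A.
  by rewrite !inE submx1 andbT -!andbA.
rewrite -(mxrank_gen R) -(card_chain her hext) ?genmx_subspace ?genmxE //.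
by congr (_ %:R); apply: eq_card => A; rewrite !inE genmxE -!andbA.
Qed.

(** The factors [br (m.+1 - i) / br (m - i)] telescope. The value is the number of hyperplanes of an
    [m.+1]-space through an [s]-space. *)
Lemma chain_num_hyper (s m : nat) : (s <= m)%N ->
  chain_num F (fun i => br (m.+1 - i)) s m = br (m.+1 - s).
Proof.
move: {2}(m - s)%N (erefl (m - s)%N) => d; elim: d s => [|d IH] s hd le.
  have -> : s = m by lia.
  by rewrite chain_num_id subSn // subnn qint1.
have b0 k : (0 < k)%N -> br k != 0 by move=> k0; rewrite gt_eqF // qint_gt0.
apply: (mulIf (b0 (m - s)%N _)); first by lia.
rewrite (@chain_numS _ (fun i => br (m.+1 - i))); last by apply: b0; lia.
by rewrite IH; lia || rewrite subSS.
Qed.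

Lemma card_hyperplanes_above (E R : sub) (m : nat) :
  (R <= E)%MS -> \rank E = m.+1 ->
  #|[set A in subs_of E m | (R <= A)%MS]|%:R = br (m.+1 - \rank R).
Proof.
move=> sRE rE; have rRE := mxrankS sRE; rewrite card_subs_above // rE.
rewrite rE in rRE; have [le|lt] := leqP (\rank R) m.
  exact: chain_num_hyper.
rewrite /chain_num leqNgt lt /= (_ : (_ - _)%N = 0%N) ?qint0 //; lia.
Qed.

Lemma card_subs_hyper (E : sub) (m : nat) : \rank E = m.+1 ->
  #|subs_of E m|%:R = br m.+1.
Proof.
move=> rE; have := card_hyperplanes_above (sub0mx _ E) rE; rewrite mxrank0 subn0 => <-.
by congr (_ %:R); apply: eq_card => A; rewrite !inE sub0mx andbT.
Qed.

(** The Gaussian binomial coefficient of [t + s] over [t]. Recursion on the codimension [s] displays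
    the ratio of consecutive values, which is what the comparison of covers of growing rank
    needs. *)
Fixpoint gauss (t s : nat) : rat :=
  if s is s'.+1 then gauss t s' * br (t + s) / br s else 1.

Lemma gauss_gt0 t s : 0 < gauss t s.
Proof.
elim: s => //= s IH; rewrite divr_gt0 ?mulr_gt0 ?qint_gt0 //; lia.
Qed.

Lemma chain_num_gauss t s : chain_num F (fun i => br (t + s - i)) 0 t = gauss t s.
Proof.
have b0 k : (0 < k)%N -> br k != 0 by move=> k0; rewrite gt_eqF // qint_gt0.
rewrite /chain_num leq0n big_mkord.
elim: s => [|s IH] /=.
  by rewrite big1 // => i _; rewrite addn0 divff // b0 // subn_gt0.
rewrite -IH; rewrite !big_split /=; set D := \prod_(i < t) (br _)^-1.
(* Both sides are the product of [br (t + s.+1 - i)] over [i < t.+1], with the last or the first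
   factor split off. *)
suff H : (\prod_(i < t) br (t + s.+1 - i)) * br s.+1 =
    br (t + s.+1) * \prod_(i < t) br (t + s - i).
  apply: (mulIf (b0 s.+1 isT)); rewrite -[RHS]mulrA mulVf ?b0 // mulr1.
  by rewrite mulrAC H; ring.
have <- : \prod_(i < t.+1) br (t + s.+1 - i) =
    (\prod_(i < t) br (t + s.+1 - i)) * br s.+1.
  by rewrite big_ord_recr /= addKn.
rewrite big_ord_recl /= subn0; congr (_ * _).
by apply: eq_bigr => i _; rewrite /bump /= addnS subSS.
Qed.

Lemma card_subs_gauss (E : sub) (t s : nat) : \rank E = (t + s)%N ->
  #|subs_of E t|%:R = gauss t s.
Proof.
move=> rE; have := card_subs_above t (sub0mx _ E).
rewrite mxrank0 rE chain_num_gauss => <-.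
by congr (_ %:R); apply: eq_card => A; rewrite !inE sub0mx andbT.
Qed.

End SubspaceCounts.

(** * Totally isotropic subspaces and their numbers *)

Section Isotropic.
Variables (F : finFieldType) (nu : nat) (J : 'M[F]_(2 * nu)).
Hypothesis HJ : nondeg_alt J.
Local Notation n := (2 * nu)%N.
Local Notation sub := 'M[F]_n.
Local Notation q := #|F|.
Local Notation br := (qint #|F|).
Let q1 := card_F_gt1 F.

Lemma bformE (x y : 'rV[F]_n) : (x *m J *m y^T) = (bform J x y)%:M.
Proof. by rewrite /bform [LHS]mx11_scalar. Qed.

Lemma bformC (x y : 'rV[F]_n) : bform J y x = - bform J x y.
Proof.
have [_ alt] := HJ; apply/eqP; rewrite -addr_eq0 addrC; apply/eqP.
have : bform J (x + y) (x + y) =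
    bform J x x + bform J y y + (bform J x y + bform J y x).
  rewrite /bform linearD /= mulmxDl !mulmxDr !mulmxDl !mxE; ring.
by rewrite !alt !add0r.
Qed.

Lemma trmx_form : J^T = - J.
Proof.
apply/matrixP => i j; rewrite !mxE.
have e k l : J k l = bform J (delta_mx 0 k) (delta_mx 0 l).
  by rewrite /bform -rowE trmx_delta -colE !mxE.
by rewrite (e j i) (e i j) bformC.
Qed.

Lemma form_sym m1 m2 (A : 'M[F]_(m1, n)) (B : 'M[F]_(m2, n)) :
  A *m J *m B^T = 0 -> B *m J *m A^T = 0.
Proof.
move/(congr1 trmx); rewrite !trmx_mul trmxK trmx_form trmx0 mulNmx mulmxN.
by rewrite mulmxA => /eqP; rewrite oppr_eq0 => /eqP.
Qed.

Lemma form_sub m1 m2 m3 m4 (A : 'M[F]_(m1, n)) (B : 'M[F]_(m2, n))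
    (C : 'M[F]_(m3, n)) (D : 'M[F]_(m4, n)) :
  (A <= C)%MS -> (B <= D)%MS -> C *m J *m D^T = 0 -> A *m J *m B^T = 0.
Proof.
move=> /submxP[x ->] /submxP[y ->] h.
by rewrite trmx_mul -!mulmxA [C *m _]mulmxA [C *m J *m _]mulmxA h mul0mx mulmx0.
Qed.

Lemma tot_isoP (A : sub) : reflect (A *m J *m A^T = 0) (tot_iso J A).
Proof.
apply: (iffP forallP) => [h|h x].
  apply/matrixP => i j; have /forallP/(_ (row j A)) := h (row i A).
  rewrite !row_sub /= => /eqP; rewrite /bform => e.
  rewrite [RHS]mxE -[RHS]e !mxE; apply: eq_bigr => k _; rewrite !mxE.
  by congr (_ * _); apply: eq_bigr => l _; rewrite !mxE.
apply/forallP => y; apply/implyP => /andP[xA yA].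
by rewrite /bform (form_sub xA yA h) mxE.
Qed.

Lemma tot_iso_sub (A B : sub) : tot_iso J B -> (A <= B)%MS -> tot_iso J A.
Proof. by move=> /tot_isoP h s; apply/tot_isoP/(form_sub s s h). Qed.

Lemma tot_iso_gen (A : sub) : tot_iso J <<A>>%MS = tot_iso J A.
Proof. by apply/idP/idP => /tot_iso_sub -> //; rewrite genmxE. Qed.

Definition perp (A : sub) : sub := kermx (J *m A^T).

Lemma sub_perp m (B : 'M[F]_(m, n)) (A : sub) :
  (B <= perp A)%MS = (B *m J *m A^T == 0).
Proof. by rewrite -mulmxA; apply/sub_kermxP/eqP. Qed.

Lemma rank_perp (A : sub) : \rank (perp A) = (n - \rank A)%N.
Proof.
have [uJ _] := HJ; rewrite mxrank_ker; congr (_ - _)%N.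
have fJ : row_full J by rewrite row_full_unit.
by rewrite (eqmxMfull _ fJ) mxrank_tr.
Qed.

Lemma tot_iso_adds (A : sub) m (B : 'M[F]_(m, n)) (C : sub) :
  tot_iso J A -> B *m J *m B^T = 0 -> (B <= perp A)%MS ->
  (C <= A + B)%MS -> tot_iso J C.
Proof.
move=> /tot_isoP hA hB; rewrite sub_perp => /eqP hBA; rewrite addsmxE => sC.
apply/tot_isoP/(form_sub sC sC).
rewrite mul_col_mx tr_col_mx mul_col_row hA hB hBA (form_sym hBA).
exact: block_mx_const.
Qed.

(** [A] is [R] plus one vector, and that vector is orthogonal to itself since the form is
    alternating; only orthogonality to [R] remains. Hence isotropic extensions of [R] are the points
    of [perp R / R], of dimension [n - 2 * \rank R]. *)
Lemma tot_iso_ext (R A : sub) : tot_iso J R -> \rank A = (\rank R).+1 ->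
  (R <= A)%MS -> tot_iso J A = (A <= perp R)%MS.
Proof.
move=> hR rA sRA; apply/idP/idP => [/tot_isoP hA|sA].
  by rewrite sub_perp (form_sub (submx_refl A) sRA hA).
have nAR : ~~ (A <= R)%MS by apply/negP => /mxrankS; rewrite rA ltnn.
have /row_subPn[i nv] := nAR.
have vA := row_sub i A.
apply: (tot_iso_adds hR (B := row i A)).
- by have [_ alt] := HJ; rewrite bformE alt raddf0.
- exact: submx_trans sA.
have s : (R + row i A <= A)%MS by rewrite addsmx_sub sRA.
have [_ <-] := mxrank_leqif_sup s.
by rewrite rank_adds_row // rA.
Qed.

Lemma card_tot_iso_ext (R : sub) : tot_iso J R ->
  #|[set A in ext R 1%:M | tot_iso J A]|%:R = br (n - 2 * \rank R).
Proof.
move=> hR; have sR : (R <= perp R)%MS by rewrite sub_perp; apply/eqP/tot_isoP.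
have -> : (n - 2 * \rank R = \rank (perp R) - \rank R)%N.
  by rewrite rank_perp; lia.
rewrite -card_ext //; congr (_ %:R); apply: eq_card => A; rewrite !inE submx1 andbT.
have [rA|] := eqVneq; last by rewrite !andbF.
case sRA: (R <= A)%MS; last by rewrite !andbF.
by rewrite (tot_iso_ext hR rA sRA) -!andbA.
Qed.

Definition Pnum (s m : nat) : rat := chain_num F (fun i => br (n - 2 * i)) s m.

Lemma Pnum_ge0 s m : 0 <= Pnum s m.
Proof. by apply: chain_num_ge0 => i; exact: qint_ge0. Qed.

Lemma Pnum_gt0 s m : (s <= m)%N -> (m <= nu)%N -> 0 < Pnum s m.
Proof. by move=> sm mn; apply: chain_num_gt0 => // i im; rewrite qint_gt0 //; lia. Qed.

Lemma Pnum_id m : Pnum m m = 1.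
Proof. exact: chain_num_id. Qed.

Lemma PnumS s m : (s < nu)%N ->
  Pnum s m * br (m - s) = br (n - 2 * s) * Pnum s.+1 m.
Proof.
move=> sn; apply: (@chain_numS F (fun i => br (n - 2 * i))).
by rewrite gt_eqF // qint_gt0 //; lia.
Qed.

Lemma Pnum_eq0 s m : (m < s)%N -> Pnum s m = 0.
Proof. by rewrite ltnNge /Pnum /chain_num => /negbTE ->. Qed.

Definition above (m : nat) (R : sub) : {set sub} := [set A in Pm J m | (R <= A)%MS].

Lemma card_above (R : sub) m : tot_iso J R -> #|above m R|%:R = Pnum (\rank R) m.
Proof.
move=> hR; rewrite -(mxrank_gen R) /Pnum.
rewrite -(card_chain (good := tot_iso J) (e := fun i => br (n - 2 * i))).
- by congr (_ %:R); apply: eq_card => A; rewrite !inE genmxE -!andbA.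
- by move=> A B hB sAB; apply: tot_iso_sub sAB.
- by move=> S _ hS _; apply: card_tot_iso_ext.
- exact: genmx_subspace.
- by rewrite tot_iso_gen.
Qed.

Lemma card_above_le (R : sub) m : #|above m R|%:R <= Pnum (\rank R) m.
Proof.
case hR: (tot_iso J R); first by rewrite card_above.
rewrite (_ : above m R = set0) ?cards0 ?Pnum_ge0 //; apply/setP => A; rewrite !inE.
by apply/negP => /andP[/and3P[_ _ hA] /(tot_iso_sub hA)]; rewrite hR.
Qed.

Lemma Pm_ext_exists (R : sub) m : tot_iso J R -> (\rank R <= m)%N ->
  (m <= nu)%N -> exists2 A, A \in Pm J m & (R <= A)%MS.
Proof.
move=> hR rm mn; have : 0 < (#|above m R|%:R : rat).
  by rewrite card_above // Pnum_gt0.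
by rewrite ltr0n card_gt0 => /set0Pn[A]; rewrite inE => /andP[]; exists A.
Qed.

End Isotropic.

Lemma card_cover_le (T1 T2 : finType) (X : {set T1}) (Y : {set T2})
    (r : T1 -> T2 -> bool) :
  (forall a, a \in X -> exists2 b, b \in Y & r a b) ->
  #|X|%:R <= \sum_(b in Y) #|[set a in X | r a b]|%:R :> rat.
Proof.
move=> h; rewrite -natr_sum ler_nat -double_count -sum1_card leq_sum // => a aX.
have [b bY rab] := h a aX; rewrite card_gt0; apply/set0Pn; exists b.
by rewrite inE bY.
Qed.

Lemma sum_le_const (T : finType) (Y : {set T}) (f : T -> rat) (c C : rat) :
  0 <= C -> #|Y|%:R <= c -> (forall b, b \in Y -> f b <= C) ->
  \sum_(b in Y) f b <= c * C.
Proof.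
move=> C0 Yc fC; apply: le_trans (ler_wpM2r C0 Yc).
by rewrite mulr_natl -sumr_const; apply: ler_sum.
Qed.

(** * Covers and the bounds they give *)

Section Covers.
Variables (F : finFieldType) (nu : nat).
Local Notation n := (2 * nu)%N.
Local Notation sub := 'M[F]_n.
Local Notation br := (qint #|F|).
Let q1 := card_F_gt1 F.

Lemma between_exists (A B : sub) r : (A <= B)%MS ->
  (\rank A <= r <= \rank B)%N ->
  exists C : sub, [/\ (A <= C)%MS, (C <= B)%MS & \rank C = r].
Proof.
move=> sAB; move: {2}(r - _)%N (erefl (r - \rank A)%N) => d.
elim: d A sAB => [|d IH] A sAB hd /andP[h1 h2].
  by exists A; split=> //; lia.
have [|A'] := ext_neq0 sAB; first by lia.
rewrite inE => /and4P[_ /eqP rA' sAA' sA'B].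
have [||C [sA'C sCB rC]] := IH A' sA'B; [lia|lia|exists C; split=> //].
exact: submx_trans sA'C.
Qed.

Lemma rank_cap_ge (A G G' : sub) : (G' <= G)%MS ->
  (\rank (A :&: G) + \rank G' <= \rank (A :&: G') + \rank G)%N.
Proof.
move=> sG; have := mxrank_sum_cap (A :&: G)%MS G'.
have -> : \rank ((A :&: G) :&: G')%MS = \rank (A :&: G')%MS.
  apply: eqmx_rank; apply/andP; split; rewrite !sub_capmx.
    by rewrite (submx_trans (capmxSl _ _)) ?capmxSl ?capmxSr.
  by rewrite capmxSl capmxSr (submx_trans _ sG) ?capmxSr.
have : (\rank (A :&: G + G')%MS <= \rank G)%N.
  by apply: mxrankS; rewrite addsmx_sub capmxSr.
lia.
Qed.

Definition containing (X : {set sub}) (R : sub) : {set sub} :=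
  [set A in X | (R <= A)%MS].

(* With [j = \rank (S :&: G)], members of [X] above [S] meet any [G'] of rank
   [\rank G + j + 1 - t] between [S :&: G] and [G] outside [S]; hence the number
   of extensions of [S] needed does not depend on [j] *)
Lemma step_cover (X : {set sub}) (S G : sub) t :
  (t <= \rank G)%N -> (\rank (S :&: G)%MS < t)%N ->
  (forall A, A \in X -> (t <= \rank (A :&: G)%MS)%N) ->
  exists RR : {set sub}, [/\ #|RR|%:R <= br (\rank G - t).+1 :> rat,
    RR \subset ext S 1%:M &
    forall A, A \in containing X S -> exists2 R, R \in RR & (R <= A)%MS].
Proof.
move=> tG jt hX; set j := \rank (S :&: G)%MS in jt.
have [||G' [sG1 sG2 rG']] :=
  @between_exists (S :&: G)%MS G (\rank G + j.+1 - t)%N.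
- exact: capmxSr.
- by rewrite -/j; lia.
have rSG' : \rank (S :&: G')%MS = j.
  apply: eqmx_rank; apply/andP; split.
    by apply: capmxS.
  by rewrite sub_capmx capmxSl.
exists (ext S (S + G')%MS); split.
- rewrite card_ext ?addsmxSl // le_qint //.
  by have := mxrank_sum_cap S G'; rewrite rSG' rG'; lia.
- by apply/subsetP => A; rewrite !inE submx1 => /and4P[-> -> -> _].
move=> A; rewrite inE => /andP[/hX tA sSA].
have nAS : ~~ ((A :&: G')%MS <= S)%MS.
  apply/negP => h; have h2 : ((A :&: G')%MS <= S :&: G')%MS.
    by rewrite sub_capmx h capmxSr.
  have := mxrankS h2; have := rank_cap_ge A sG2; rewrite rSG'; lia.
have /row_subPn[i nv] := nAS; set v := row i _ in nv.
have /andP[vA vG'] : ((v <= A) && (v <= G'))%MS by rewrite -sub_capmx row_sub.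
exists <<(S + v)%MS>>%MS; last by rewrite genmxE addsmx_sub sSA.
by apply: ext_mem; rewrite ?addsmxSl // (submx_trans vG') ?addsmxSr.
Qed.

End Covers.

Section CrossIntersecting.
Variables (F : finFieldType) (nu : nat) (J : 'M[F]_(2 * nu)).
Hypothesis HJ : nondeg_alt J.
Local Notation n := (2 * nu)%N.
Local Notation sub := 'M[F]_n.
Local Notation q := #|F|.
Local Notation br := (qint #|F|).
Local Notation N := (Pnum F nu).
Let q1 := card_F_gt1 F.

Lemma PmP m A : reflect [/\ is_subspace A, \rank A = m & tot_iso J A] (A \in Pm J m).
Proof. by rewrite inE; apply: (iffP and3P) => [][-> /eqP-> ->]. Qed.

Definition tcover (t : nat) (Y : {set sub}) (C : sub) : bool :=
  [forall G in Y, (t <= \rank (C :&: G)%MS)%N].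

Lemma not_coverP t (Y : {set sub}) C :
  reflect (exists2 G, G \in Y & (\rank (C :&: G)%MS < t)%N) (~~ tcover t Y C).
Proof.
rewrite negb_forall_in; apply: (iffP exists_inP) => -[G hG h]; exists G => //.
  by rewrite ltnNge.
by rewrite -ltnNge.
Qed.

Variables (X Y : {set sub}) (a b t : nat).
Hypotheses (XP : X \subset Pm J a) (YP : Y \subset Pm J b).
Hypotheses (cXY : cross_int t X Y) (tb : (t <= b)%N).

Lemma containing_le R : #|containing X R|%:R <= N (\rank R) a.
Proof.
apply: le_trans (card_above_le HJ R a); rewrite ler_nat subset_leq_card //.
by apply/subsetP => A; rewrite !inE => /andP[/(subsetP XP)]; rewrite inE => -> ->.
Qed.

Lemma containing_step S C : ~~ tcover t Y S -> 0 <= C ->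
  (forall R, R \in ext S 1%:M -> #|containing X R|%:R <= C) ->
  #|containing X S|%:R <= br (b - t).+1 * C.
Proof.
move=> /not_coverP[G GY hG] C0 hC; have /PmP[_ rG _] := subsetP YP _ GY.
have [|A AX|RR [cRR /subsetP sRR hRR]] := @step_cover _ _ X S G t _ hG.
- by rewrite rG.
- exact: cXY AX GY.
apply: le_trans (card_cover_le hRR) _; rewrite rG in cRR.
apply: sum_le_const => // R RR1; apply: le_trans (hC R (sRR _ RR1)).
rewrite ler_nat subset_leq_card //; apply/subsetP => A; rewrite !inE.
by case/andP => /andP[-> _] ->.
Qed.

(** Each covering step gains one dimension at the cost of a factor [br (b - t).+1]. It suffices to
    exclude isotropic covers, since a subspace that is not isotropic lies in no member of [X]. [T0]
    will be 0, or the common subspace of [X]. *)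
Lemma containing_iter (T0 : sub) tau :
  (forall C : sub, is_subspace C -> tot_iso J C -> (T0 <= C)%MS ->
     (t <= \rank C < tau)%N -> ~~ tcover t Y C) ->
  forall S : sub, is_subspace S -> (T0 <= S)%MS -> (t <= \rank S <= tau)%N ->
  #|containing X S|%:R <= br (b - t).+1 ^+ (tau - \rank S) * N tau a.
Proof.
move=> htau S sS T0S; move: {2}(tau - _)%N (erefl (tau - \rank S)%N) => d.
elim: d S sS T0S => [|d IH] S sS T0S hd /andP[tS St].
  rewrite hd expr0 mul1r; have <- : \rank S = tau by lia.
  exact: containing_le.
have C0 : 0 <= br (b - t).+1 ^+ d * N tau a.
  by rewrite mulr_ge0 ?exprn_ge0 ?qint_ge0 ?Pnum_ge0.
rewrite hd exprS -mulrA; case iS: (tot_iso J S); last first.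
  have -> : containing X S = set0.
    apply/setP => A; rewrite !inE; apply/negP => /andP[/(subsetP XP)/PmP[_ _ iA]].
    by move/(tot_iso_sub iA); rewrite iS.
  by rewrite cards0 mulr_ge0 ?qint_ge0.
apply: containing_step => //; first by apply: htau => //; lia.
move=> R; rewrite inE => /and4P[sR /eqP rR sSR _].
have -> : d = (tau - \rank R)%N by lia.
by apply: IH => //; [exact: submx_trans sSR|lia|lia].
Qed.

(** Every member of [X] contains a [t]-subspace of the cover [C], and there are [gauss F t s] of
    these. *)
Lemma card_cover_bound (C : sub) s :
  \rank C = (t + s)%N -> tcover t X C -> 
  forall B, (forall T, T \in subs_of C t -> #|containing X T|%:R <= B) -> 0 <= B ->
  #|X|%:R <= gauss F t s * B.
Proof.
move=> rC /forall_inP hC B hB B0.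
have h A : A \in X -> exists2 T, T \in subs_of C t & (T <= A)%MS.
  move=> AX; have [||T [_ sT rT]] := @between_exists _ _ 0 (C :&: A)%MS t.
  - exact: sub0mx.
  - by rewrite mxrank0 hC.
  exists <<T>>%MS; last by rewrite genmxE (submx_trans sT) ?capmxSr.
  rewrite inE genmx_subspace !genmxE rT eqxx /=.
  by rewrite (submx_trans sT) ?capmxSl.
apply: le_trans (card_cover_le h) _.
by apply: sum_le_const => //; rewrite (card_subs_gauss rC).
Qed.

End CrossIntersecting.

(** * Covers of minimal rank, and pairs in which neither family has a common [t]-space *)

Section MinimalCovers.
Variables (F : finFieldType) (nu : nat) (J : 'M[F]_(2 * nu)).
Hypothesis HJ : nondeg_alt J.
Local Notation n := (2 * nu)%N.
Local Notation sub := 'M[F]_n.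
Local Notation q := #|F|.
Local Notation br := (qint #|F|).
Local Notation N := (Pnum F nu).
Let q1 := card_F_gt1 F.

(** A member of [X] is itself an isotropic cover of [Y] above [T0], so a minimal one exists. Its
    rank controls both families: minimality bounds [X] through [containing_iter], and the covering
    property bounds [Y] through [card_cover_bound]. *)
Lemma min_cover (X Y : {set sub}) (a t : nat) (T0 : sub) :
  X \subset Pm J a -> cross_int t X Y -> X != set0 ->
  (forall A, A \in X -> (T0 <= A)%MS) ->
  exists C : sub, [/\ is_subspace C, tot_iso J C, (T0 <= C)%MS,
      tcover t Y C & (\rank C <= a)%N] /\
    forall C' : sub, is_subspace C' -> tot_iso J C' -> (T0 <= C')%MS ->
      (\rank C' < \rank C)%N -> ~~ tcover t Y C'.
Proof.
move=> /subsetP XP cXY /set0Pn[A0 A0X] hT.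
pose P r := [exists C : sub, [&& is_subspace C, tot_iso J C, (T0 <= C)%MS,
  tcover t Y C & \rank C == r]].
have Pa : P a.
  have /PmP[sA rA iA] := XP _ A0X; apply/existsP; exists A0.
  rewrite sA iA hT // rA eqxx /= andbT.
  by apply/forall_inP => G; apply: cXY.
have exP : exists r, P r by exists a.
case: (ex_minnP exP) => r /existsP[C /and5P[sC iC TC cC /eqP rC]] hmin.
exists C; split; first by split=> //; rewrite rC hmin.
move=> C' sC' iC' TC' lt; apply/negP => cC'.
have : P (\rank C') by apply/existsP; exists C'; rewrite sC' iC' TC' cC' eqxx.
by move/hmin; lia.
Qed.

Lemma cover_rank (Y : {set sub}) (t : nat) (C : sub) :
  Y != set0 -> tcover t Y C -> (t <= \rank C)%N.
Proof.
move=> /set0Pn[G GY] /forall_inP/(_ G GY)/leq_trans; apply.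
exact/mxrankS/capmxSl.
Qed.

(** One more dimension multiplies the bound by [br k * br (t + s).+1 * br (a - (t + s))] over
    [br s.+1 * br (n - 2 * (t + s))], with [k = (b - t).+1]. After [qintMS] cancels [br s.+1], only
    a sum of indices remains to be compared with [n - 2 * (t + s)]. *)
Lemma cover_bound_step (a b t s : nat) :
  (2 * a + b + 2 <= n)%N -> (t <= b)%N -> (t + s < a)%N ->
  br (b - t).+1 ^+ s.+1 * gauss F t s.+1 * N (t + s.+1) a
  <= br (b - t).+1 ^+ s * gauss F t s * N (t + s) a.
Proof.
move=> hn tb sa /=; have b0 k : (0 < k)%N -> 0 < br k by exact: qint_gt0.
have hN := @PnumS F nu (t + s) a; rewrite addnS exprS.
set k := (b - t).+1.
have h1 : br k * br (t + s).+1 * br (a - (t + s)) <= br s.+1 * br (n - 2 * (t + s)).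
  apply: (@le_trans _ _ (br s.+1 * (br k * br t.+1 * br (a - (t + s))))).
    have := qintMS #|F| t s; have := qint_ge0 #|F| k.
    have := qint_ge0 #|F| (a - (t + s)).
    move=> x0 y0 h; have := ler_wpM2l (mulr_ge0 y0 x0) h; lra.
  apply: ler_wpM2l; first exact: qint_ge0.
  apply: (@le_trans _ _ (br (k + t.+1) * br (a - (t + s)))).
    by apply: ler_wpM2r; rewrite ?qint_ge0 ?qintM.
  by apply: le_trans (qintM q1 _ _) _; apply: le_qint => //; rewrite /k; lia.
have c0 : 0 < br s.+1 * br (a - (t + s)) by rewrite mulr_gt0 // b0 //; lia.
rewrite -(ler_pM2r c0); set K := br k ^+ s; set g := gauss F t s.
have K0 : 0 <= K by rewrite exprn_ge0 ?qint_ge0.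
have g0 : 0 <= g by rewrite ltW ?gauss_gt0.
have N0 := Pnum_ge0 F nu (t + s).+1 a.
have -> : K * g * N (t + s) a * (br s.+1 * br (a - (t + s))) =
   K * g * N (t + s).+1 a * (br s.+1 * br (n - 2 * (t + s))).
  have : (t + s < nu)%N by lia.
  by move/hN/(congr1 (fun z => K * g * br s.+1 * z)); lra.
have -> : br k * K * (g * br (t + s).+1 / br s.+1) * N (t + s).+1 a *
   (br s.+1 * br (a - (t + s))) =
   K * g * N (t + s).+1 a * (br k * br (t + s).+1 * br (a - (t + s))).
  have : br s.+1 != 0 by rewrite gt_eqF ?b0.
  by move=> s0; field.
by apply: ler_wpM2l => //; rewrite !mulr_ge0.
Qed.

Lemma cover_bound_mono (a b t s0 s : nat) :
  (2 * a + b + 2 <= n)%N -> (t <= b)%N -> (s0 <= s)%N -> (t + s <= a)%N ->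
  br (b - t).+1 ^+ s * gauss F t s * N (t + s) a
  <= br (b - t).+1 ^+ s0 * gauss F t s0 * N (t + s0) a.
Proof.
move=> hn tb; elim: s => [|s IH]; first by rewrite leqn0 => /eqP ->.
rewrite leq_eqVlt => /orP[/eqP -> //|]; rewrite ltnS => le sa.
apply: le_trans (cover_bound_step hn tb _) (IH le _); lia.
Qed.

Lemma gauss1 t : gauss F t 1 = br t.+1.
Proof. by rewrite /= mul1r addn1 qint1 divr1. Qed.

Lemma cross_bound_no_common (X Y : {set sub}) (a b t : nat) :
  (2 * a + b + 2 <= n)%N -> (2 * b + a + 2 <= n)%N ->
  (a + b + 4 <= n - 2 * t)%N -> (t <= a)%N -> (t <= b)%N ->
  X \subset Pm J a -> Y \subset Pm J b -> cross_int t X Y ->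
  X != set0 -> Y != set0 ->
  (forall T, T \in Pm J t -> exists2 A, A \in X & ~~ (T <= A)%MS) ->
  (forall T, T \in Pm J t -> exists2 A, A \in Y & ~~ (T <= A)%MS) ->
  #|X|%:R * #|Y|%:R <= br (n - 2 * t) * N t.+1 a * N t.+1 b.
Proof.
move=> h1 h2 h3 ta tb.
have hk : br (b - t).+1 * br t.+1 * (br (a - t).+1 * br t.+1) <= br (n - 2 * t).
  apply: (@le_trans _ _ (br ((b - t).+1 + t.+1) * br ((a - t).+1 + t.+1))).
    by apply: ler_pM; rewrite ?mulr_ge0 ?qint_ge0 ?qintM.
  by apply: le_trans (qintM q1 _ _) _; apply: le_qint => //; lia.
move=> XP YP cXY X0 Y0 nX nY.
have cYX : cross_int t Y X by move=> A B AY BX; rewrite capmxC cXY.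
(* A cover of rank exactly [t] would be contained in every member, that is, would be a common
   [t]-space. *)
have ncov (Z : {set sub}) c : Z \subset Pm J c ->
    (forall T, T \in Pm J t -> exists2 A, A \in Z & ~~ (T <= A)%MS) ->
    forall C : sub, is_subspace C -> tot_iso J C -> \rank C = t -> ~~ tcover t Z C.
  move=> ZP nZ C sC iC rC; have /nZ[A AZ nA] : C \in Pm J t by apply/PmP.
  apply/not_coverP; exists A => //; rewrite ltnNge; apply: contra nA => h.
  have s := capmxSl C A; have [_ e] := mxrank_leqif_sup s.
  have : (C <= C :&: A)%MS by rewrite -e eqn_leq mxrankS // rC.
  by rewrite sub_capmx => /andP[].
have [C [[sC iC _ cC rC] hC]] :=
  min_cover (T0 := 0) XP cXY X0 (fun A _ => sub0mx _ A).
have [D [[sD iD _ cD rD] hD]] :=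
  min_cover (T0 := 0) YP cYX Y0 (fun A _ => sub0mx _ A).
have tC : (t < \rank C)%N.
  rewrite ltn_neqAle (cover_rank Y0 cC) andbT; apply: contraL cC => /eqP e.
  exact: (ncov Y b).
have tD : (t < \rank D)%N.
  rewrite ltn_neqAle (cover_rank X0 cD) andbT; apply: contraL cD => /eqP e.
  exact: (ncov X a).
have key (X' Y' : {set sub}) a' b' (C' D' : sub) :
   X' \subset Pm J a' -> Y' \subset Pm J b' ->
   cross_int t X' Y' -> (t <= b')%N -> (\rank D' > t)%N -> (\rank C' > t)%N ->
   tcover t X' D' -> 
   (forall C1 : sub, is_subspace C1 -> tot_iso J C1 -> ((0 : sub) <= C1)%MS ->
      (\rank C1 < \rank C')%N -> ~~ tcover t Y' C1) ->
   #|X'|%:R <= gauss F t (\rank D' - t) *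
      (br (b' - t).+1 ^+ (\rank C' - t) * N (\rank C') a').
  move=> XP' YP' c' tb' tD' tC' cD' hC'.
  apply: (card_cover_bound (C := D')) => //; first by rewrite subnKC // ltnW.
    move=> T; rewrite inE => /and3P[sT /eqP rT TD]; rewrite -{2}rT.
    apply: (containing_iter HJ XP' YP' c' tb' (T0 := 0)) => //.
    - by move=> C1 s1 i1 T1 /andP[_ lt]; apply: hC'.
    - exact: sub0mx.
    - by rewrite rT leqnn ltnW.
  by rewrite mulr_ge0 ?exprn_ge0 ?qint_ge0 ?Pnum_ge0.
have kX := key X Y a b C D XP YP cXY tb tD tC cD hC.
have kY := key Y X b a D C YP XP cYX ta tC tD cC hD.
have := cover_bound_mono (a := a) (b := b) (t := t) (s0 := 1) (s := \rank C - t) h1 tb.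
have := cover_bound_mono (a := b) (b := a) (t := t) (s0 := 1) (s := \rank D - t) h2 ta.
rewrite !subn_gt0 !(subnKC (ltnW _)) // => /(_ tD rD) uY /(_ tC rC) uX.
move: uX uY; rewrite !gauss1 !addn1 !expr1 => uX uY.
have g0 s := ltW (gauss_gt0 F t s); have p0 := Pnum_ge0 F nu.
have e0 k m : 0 <= br k ^+ m by rewrite exprn_ge0 ?qint_ge0.
apply: le_trans (ler_pM _ _ kX kY) _; rewrite ?ler0n //.
(* Regroup by cover rather than by family: the rank of [C] governs the power and [N] in the bound of
   [X] and the Gaussian coefficient in the bound of [Y], and these three factors together are
   monotone; likewise for [D]. *)
rewrite mulrACA [X in _ * X <= _]mulrACA.
set x1 := br _ ^+ _ in uX *; set g1 := gauss _ _ _ in uX *; set n1 := N _ a in uX *.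
set x2 := br _ ^+ _ in uY *; set g2 := gauss _ _ _ in uY *; set n2 := N _ b in uY *.
have -> : g2 * g1 * (x1 * x2 * (n1 * n2)) = x1 * g1 * n1 * (x2 * g2 * n2) by ring.
have [x1p x2p] : 0 <= x1 /\ 0 <= x2 by rewrite !e0.
have [g1p g2p] : 0 <= g1 /\ 0 <= g2 by split; apply: g0.
have [n1p n2p] : 0 <= n1 /\ 0 <= n2 by split; apply: p0.
apply: le_trans (ler_pM _ _ uX uY) _; rewrite ?mulr_ge0 //.
have := ler_wpM2r (mulr_ge0 (p0 t.+1 a) (p0 t.+1 b)) hk; lra.
Qed.

End MinimalCovers.

(** * Numerical estimates for a family with a common [t]-space *)

Section CommonNumerics.
Variables (F : finFieldType) (nu a b t : nat).
Local Notation n := (2 * nu)%N.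
Local Notation br := (qint #|F|).
Local Notation N := (Pnum F nu).
Let q1 := card_F_gt1 F.
Lemma Pnum_mono s s' m : (s <= s')%N -> (m <= nu)%N -> N s' m <= N s m.
Proof.
move=> ss' mn; have [le|lt] := leqP s' m; last by rewrite Pnum_eq0 ?Pnum_ge0.
elim: s' ss' le => [|s' IH]; first by rewrite leqn0 => /eqP ->.
rewrite leq_eqVlt => /orP[/eqP -> //|]; rewrite ltnS => ss' s'm.
apply: le_trans (IH ss' (ltnW s'm)).
have b0 : 0 < br (m - s') by rewrite qint_gt0 // subn_gt0.
have e : N s' m * br (m - s') = br (n - 2 * s') * N s'.+1 m.
  by apply: PnumS; lia.
rewrite -(ler_pM2r b0) e mulrC ler_wpM2r ?Pnum_ge0 //.
apply: le_qint; lia.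
Qed.

Lemma qint_succ_le x : (0 < x)%N -> br x.+1 <= br 2 * br x.
Proof.
by move=> x0; rewrite qintS qint2; have := qint_ge1 q1 x0; lra.
Qed.

Lemma qint_prod4 x y z w m : (x + y + z + w <= m)%N ->
  br x * br y * br z * br w <= br m.
Proof.
move=> h; apply: (@le_trans _ _ (br (x + y + z + w))); last exact: le_qint.
apply: le_trans (qintM q1 _ _); apply: ler_wpM2r; first exact: qint_ge0.
apply: le_trans (qintM q1 _ _); apply: ler_wpM2r; first exact: qint_ge0.
exact: qintM.
Qed.

Hypotheses (hn : (a + b + maxn a b + t + 3 <= n)%N) (t0 : (0 < t)%N).
Hypotheses (ta : (t < a)%N) (tb : (t < b)%N).

(** The case [s = 2] of the cover bound, used when no isotropic cover above [T] has rank [t.+1]. The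
    denominator [br 2] of the Gaussian coefficient pays for [br (b - t).+1 <= br 2 * br (b - t)]. *)
Lemma two_step_bound : (t.+2 <= a)%N ->
  br (b - t).+1 ^+ 2 * gauss F t 2 * N (t + 2) a <= br (b - t) * N t.+1 a.
Proof.
move=> ta2; rewrite addn2 /= mul1r addn1 addn2 qint1 divr1.
have a0 : 0 < br (a - t.+1) by rewrite qint_gt0 // subn_gt0.
have e : N t.+1 a * br (a - t.+1) = br (n - 2 * t.+1) * N t.+2 a.
  by apply: PnumS; lia.
have c0 : 0 < br 2 by rewrite qint_gt0.
have h : br (b - t).+1 ^+ 2 * br t.+1 * br t.+2 * br (a - t.+1)
   <= br 2 * br (b - t) * br (n - 2 * t.+1).
  have h1 : br (b - t).+1 * br t.+1 * br t.+2 * br (a - t.+1) <= br (n - 2 * t.+1).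
    by apply: qint_prod4; lia.
  have h2 : br (b - t).+1 <= br 2 * br (b - t) by apply: qint_succ_le; lia.
  rewrite expr2 -!mulrA; rewrite -!mulrA in h1; rewrite [br 2 * _]mulrA.
  by apply: ler_pM; rewrite ?mulr_ge0 ?qint_ge0.
rewrite -(ler_pM2r a0) -[br (b - t) * _ * _]mulrA e -(ler_pM2r c0).
set X := br (b - t).+1 ^+ 2 in h *.
have -> : X * (br t.+1 * br t.+2 / br 2) * N t.+2 a * br (a - t.+1) * br 2 =
   N t.+2 a * (X * br t.+1 * br t.+2 * br (a - t.+1)).
  by have c0' : br 2 != 0; [rewrite gt_eqF|field].
have -> : br (b - t) * (br (n - 2 * t.+1) * N t.+2 a) * br 2 =
   N t.+2 a * (br 2 * br (b - t) * br (n - 2 * t.+1)) by ring.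
by apply: ler_wpM2l => //; exact: Pnum_ge0.
Qed.

(** The extensions of [T] outside the span of the covers add at most a quarter of the main term: the
    source of the factor 5/4. *)
Lemma X_bound_numeric :
  4 * (br (b - t).+1 ^+ 2 * N t.+2 a) <= br (b - t) * N t.+1 a.
Proof.
have [ta2|ta2] := ltnP t.+1 a; last first.
  by rewrite [N t.+2 a]Pnum_eq0 // !mulr0 mulr_ge0 ?qint_ge0 ?Pnum_ge0.
have a0 : 0 < br (a - t.+1) by rewrite qint_gt0 // subn_gt0.
have e : N t.+1 a * br (a - t.+1) = br (n - 2 * t.+1) * N t.+2 a.
  by apply: PnumS; lia.
have h1 : br (b - t).+1 * br (a - t.+1) * br 2 * 4 <= br (n - 2 * t.+1).
  rewrite mulrC; apply: (@le_trans _ _ (br ((b - t).+1 + (a - t.+1) + 2 + 2))).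
    have -> : 4 = 2 ^+ 2 :> rat by ring.
    apply: le_trans (qint_pow2 q1 _ _).
    rewrite ler_pM2l //; apply: le_trans (qintM q1 _ _); apply: ler_wpM2r; first exact: qint_ge0.
    exact: qintM.
  apply: le_qint; lia.
have h2 : br (b - t).+1 <= br 2 * br (b - t) by apply: qint_succ_le; lia.
rewrite -(ler_pM2r a0) -[br (b - t) * _ * _]mulrA e.
have P : 0 <= br (b - t).+1 * br (a - t.+1) * br 2 * 4.
  by rewrite !mulr_ge0 ?qint_ge0.
have h3 := ler_pM P (qint_ge0 _ _) h1 h2.
have c0 : 0 < br 2 by rewrite qint_gt0.
have h4 : br (b - t).+1 ^+ 2 * br (a - t.+1) * 4 <= br (n - 2 * t.+1) * br (b - t).
  by rewrite -(ler_pM2r c0) expr2; move: h3; lra.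
have := ler_wpM2r (Pnum_ge0 F nu t.+2 a) h4; lra.
Qed.

(** The members of [Y] not above [T] add at most an eighth of [N t b]: the source of the factor 9/8.
    The two values of [c] serve a span of rank [t.+1] and a span of rank between [t.+2] and [b]. *)
Lemma Y_bound_numeric c : 
  (c = br t.+1 * br (a - t).+1 \/ c = br b) ->
  8 * (c * N t.+1 b) <= N t b.
Proof.
move=> hc; have b0 : 0 < br (n - 2 * t) by rewrite qint_gt0 //; lia.
have e : N t b * br (b - t) = br (n - 2 * t) * N t.+1 b.
  by apply: PnumS; lia.
have h : br (b - t) * c * 8 <= br (n - 2 * t).
  suff [y hy cy] : exists2 y, (b - t + y + 3 <= n - 2 * t)%N & c <= br y.
    apply: (@le_trans _ _ (br (b - t + y + 3))); last exact: le_qint.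
    rewrite mulrC; have -> : 8 = 2 ^+ 3 :> rat by ring.
    apply: le_trans (qint_pow2 q1 _ _).
    rewrite ler_pM2l //; apply: le_trans (qintM q1 _ _).
    by apply: ler_wpM2l; first exact: qint_ge0.
  case: hc => ->; last by exists b => //; lia.
  by exists (t.+1 + (a - t).+1)%N; [lia|exact: qintM].
have c0 : 0 < br (b - t) by rewrite qint_gt0 // subn_gt0.
rewrite -(ler_pM2r c0) e; have := ler_wpM2r (Pnum_ge0 F nu t.+1 b) h; lra.
Qed.

End CommonNumerics.

Ltac nat_lia :=
  repeat match goal with H : ?P |- _ => lazymatch P with
    | is_true (leq _ _) => fail
    | @eq nat _ _ => fail
    | _ => clear H
  end end; lia.

(** * One family lies above [T], the other does not *)

Section CommonSubspace.
Variables (F : finFieldType) (nu : nat) (J : 'M[F]_(2 * nu)).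
Hypothesis HJ : nondeg_alt J.
Local Notation n := (2 * nu)%N.
Local Notation sub := 'M[F]_n.
Local Notation br := (qint #|F|).
Local Notation N := (Pnum F nu).
Let q1 := card_F_gt1 F.

Variables (X Y : {set sub}) (a b t : nat) (T : sub).
Hypotheses (hn : (a + b + maxn a b + t + 3 <= n)%N) (t0 : (0 < t)%N).
Hypotheses (ta : (t < a)%N) (tb : (t < b)%N).
Hypotheses (XP : X \subset Pm J a) (YP : Y \subset Pm J b).
Hypotheses (cXY : cross_int t X Y) (X0 : X != set0).
Hypotheses (TP : T \in Pm J t) (TX : forall A, A \in X -> (T <= A)%MS).
Variable (G0 : sub).
Hypotheses (G0Y : G0 \in Y) (nTG0 : ~~ (T <= G0)%MS).

Let rT : \rank T = t. Proof. by have /PmP[] := TP. Qed.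
Let iT : tot_iso J T. Proof. by have /PmP[] := TP. Qed.
Let sT : is_subspace T. Proof. by have /PmP[] := TP. Qed.
Let rG G : G \in Y -> \rank G = b.
Proof. by move/(subsetP YP)/PmP => []. Qed.
Let cYX : cross_int t Y X.
Proof. by move=> A B AY BX; rewrite capmxC cXY. Qed.

Let rank_cap_T (G : sub) : ~~ (T <= G)%MS -> (\rank (T :&: G)%MS < t)%N.
Proof.
move=> nT; rewrite -rT ltn_neqAle mxrankS ?capmxSl // andbT.
have [_ ->] := mxrank_leqif_sup (capmxSl T G).
by apply: contra nT; rewrite sub_capmx => /andP[].
Qed.

Definition succ_covers : {set sub} :=
  [set S in Pm J t.+1 | (T <= S)%MS & tcover t Y S].

(** A minimal cover above [T] has rank at least [t.+2]: rank [t] would make it [T], which [G0]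
    prevents from covering [Y], and rank [t.+1] is excluded by assumption. *)
Lemma no_succ_cover_bound : succ_covers = set0 ->
  #|X|%:R * #|Y|%:R <= br (b - t) * N t.+1 a * N t b.
Proof.
move=> no; have Y0 : Y != set0 by apply/set0Pn; exists G0.
have [C [[sC iC TC cC rC] hC]] := min_cover XP cXY X0 TX.
have tC : (t < \rank C)%N.
  rewrite ltn_neqAle (cover_rank Y0 cC) andbT; apply: contraL cC => /eqP e.
  have <- : T = C by apply: subspace_eq => //; rewrite -e rT.
  by apply/not_coverP; exists G0 => //; exact: rank_cap_T.
have tC2 : (t.+1 < \rank C)%N.
  rewrite ltn_neqAle tC andbT; apply/eqP => e.
  have : C \in succ_covers by rewrite inE TC cC !andbT; apply/PmP.
  by rewrite no inE.
have kX : #|X|%:R <= br (b - t).+1 ^+ (\rank C - t) * N (\rank C) a.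
  rewrite (_ : X = containing X T); last first.
    by apply/setP => A; rewrite inE; case AX: (A \in X); rewrite //= TX.
  rewrite -{2}rT; apply: (containing_iter HJ XP YP cXY (ltnW tb) (T0 := T)) => //.
    by move=> C1 s1 i1 T1 /andP[_ lt]; apply: hC.
  by rewrite rT leqnn ltnW.
have kY : #|Y|%:R <= gauss F t (\rank C - t) * N t b.
  apply: (card_cover_bound (C := C)) cC _ _ (Pnum_ge0 _ _ _ _).
    by rewrite subnKC // ltnW.
  move=> S; rewrite inE => /and3P[_ /eqP <- _]; exact: (containing_le HJ YP).
have h2 : (2 * a + b + 2 <= n)%N by nat_lia.
have := cover_bound_mono F (s0 := 2) (s := \rank C - t) h2 (ltnW tb).
rewrite !(subnKC (ltnW tC)) => /(_ _ rC) uX.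
have {}uX := le_trans (uX _) (two_step_bound F hn t0 ta tb (leq_trans tC2 rC)).
move: uX => /(_ _) uX; have {}uX := uX ltac:(nat_lia).
have p0 := Pnum_ge0 F nu.
apply: le_trans (ler_pM _ _ kX kY) _; rewrite ?ler0n //.
have := ler_wpM2r (p0 t b) uX; lra.
Qed.

Definition cover_span : sub := (\sum_(S in succ_covers) S)%MS.
Local Notation M := cover_span.
Local Notation l := (\rank cover_span).

Lemma succ_cover_span (S : sub) : S \in succ_covers -> (S <= M)%MS.
Proof. by move=> h; apply: (sumsmx_sup S). Qed.

(** [S :&: G] has rank at least [t] but is not inside [T], so with [T] it fills [S]. This also
    forces [T :&: G] to have rank [t - 1], whence the rank of [T + G]. *)
Lemma succ_cover_sub (S G : sub) : S \in succ_covers -> G \in Y -> ~~ (T <= G)%MS ->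
  (S <= T + G)%MS /\ \rank (T + G)%MS = b.+1.
Proof.
rewrite inE => /and3P[/PmP[_ rS _] TS /forall_inP cS] GY nTG.
have tSG := cS G GY.
have s1 : (T + (S :&: G) <= S)%MS by rewrite addsmx_sub TS capmxSl.
have nST : ~~ ((S :&: G) <= T)%MS.
  apply: contra nTG => h; have [_ e] := mxrank_leqif_sup h.
  have : (T <= S :&: G)%MS by rewrite -e eqn_leq mxrankS // rT.
  by rewrite sub_capmx => /andP[].
have r1 : \rank (T + (S :&: G))%MS = t.+1.
  apply/eqP; rewrite eqn_leq -{1}rS mxrankS //= -{1}rT ltn_neqAle.
  rewrite mxrankS ?addsmxSl // andbT.
  have [_ ->] := mxrank_leqif_sup (addsmxSl T (S :&: G)%MS).
  by rewrite addsmx_sub submx_refl.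
split.
  have [_ e] := mxrank_leqif_sup s1.
  have s2 : (S <= T + (S :&: G))%MS by rewrite -e r1 rS.
  by apply: submx_trans s2 _; rewrite addsmxS // capmxSr.
have := mxrank_sum_cap T (S :&: G)%MS; have := mxrank_sum_cap T G.
rewrite r1 rT (rG GY); have := rank_cap_T nTG.
have : (\rank (T :&: (S :&: G))%MS <= \rank (T :&: G)%MS)%N.
  by apply: mxrankS; rewrite capmxS // capmxSr.
nat_lia.
Qed.

Hypothesis TT0 : succ_covers != set0.

Lemma T_sub_span : (T <= M)%MS.
Proof.
have /set0Pn[S SS] := TT0; apply: submx_trans (succ_cover_span SS).
by move: SS; rewrite inE => /and3P[].
Qed.

(** [G] is a hyperplane of [T + G], which contains [M], and [G] does not contain [M]; so it cuts [M]
    in a hyperplane. *)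
Lemma span_sub (G : sub) : G \in Y -> ~~ (T <= G)%MS ->
  [/\ (M <= T + G)%MS, \rank (T + G)%MS = b.+1, (l <= b.+1)%N
    & \rank (M :&: G)%MS = l.-1].
Proof.
move=> GY nTG; have h S (SS : S \in succ_covers) := succ_cover_sub SS GY nTG.
have [S SS] := set0Pn _ TT0; have [_ rTG] := h S SS.
have sM : (M <= T + G)%MS by apply/sumsmx_subP => S' /h[].
have le : (l <= b.+1)%N by rewrite -rTG mxrankS.
split=> //; have := mxrank_sum_cap M G; rewrite (rG GY).
have r1 : (\rank (M + G)%MS <= b.+1)%N.
  by rewrite -rTG mxrankS // addsmx_sub sM addsmxSr.
have r2 : (\rank (M :&: G)%MS < l)%N.
  rewrite ltn_neqAle mxrankS ?capmxSl // andbT.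
  have [_ ->] := mxrank_leqif_sup (capmxSl M G).
  by apply: contra nTG; rewrite sub_capmx => /andP[_]; apply: submx_trans T_sub_span.
nat_lia.
Qed.

Lemma span_rank_gt : (t < l)%N.
Proof.
have /set0Pn[S SS] := TT0; have := mxrankS (succ_cover_span SS).
by move: SS; rewrite inE => /and3P[/PmP[_ -> _]].
Qed.

(** Split the extensions of [T] that cover [X]. Those inside [M] number at most [br (l - t)]; those
    outside are not covers of [Y], so a second covering step applies to them. *)
Lemma X_le_span :
  #|X|%:R <= br (l - t) * N t.+1 a + br (b - t).+1 ^+ 2 * N t.+2 a.
Proof.
have p0 := Pnum_ge0 F nu.
have [|A AX|RR [cRR /subsetP sRR hRR]] :=
    @step_cover _ _ X T G0 t _ (rank_cap_T nTG0).
- by rewrite rG // ltnW.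
- exact: cXY AX G0Y.
have hX A : A \in X -> exists2 R, R \in RR & (R <= A)%MS.
  by move=> AX; apply: hRR; rewrite inE AX TX.
apply: le_trans (card_cover_le hX) _.
rewrite (big_setID (ext T M)) /=.
rewrite (rG G0Y) in cRR; apply: lerD.
  apply: sum_le_const => //.
    by rewrite -{1}rT -card_ext ?T_sub_span // ler_nat subset_leq_card // subsetIr.
  move=> R; rewrite !inE => /andP[_ /and4P[_ /eqP rR _ _]].
  by have := containing_le HJ XP R; rewrite rR rT.
rewrite expr2 -mulrA; apply: sum_le_const.
- by rewrite mulr_ge0 ?qint_ge0.
- by apply: le_trans cRR; rewrite ler_nat subset_leq_card // subsetDl.
move=> R /setDP[RRR nR]; have := sRR _ RRR; rewrite inE => /and4P[sR /eqP rR TR _].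
have nRM : ~~ (R <= M)%MS.
  by apply: contra nR => RM; rewrite inE sR rR eqxx TR.
have c0 : 0 <= br (b - t).+1 * N t.+2 a by rewrite mulr_ge0 ?qint_ge0.
case iR: (tot_iso J R); last first.
  rewrite (_ : [set _ in X | _] = set0) ?cards0 //; apply/setP => A; rewrite !inE.
  apply/negP => /andP[/(subsetP XP)/PmP[_ _ iA]].
  by move/(tot_iso_sub iA); rewrite iR.
apply: (containing_step YP cXY (ltnW tb)) => //.
- apply: contra nRM => cR; apply: succ_cover_span; rewrite inE TR cR !andbT.
  by apply/PmP; rewrite rR rT.
- move=> R'; rewrite inE => /and4P[_ /eqP rR' _ _].
  by have := containing_le HJ XP R'; rewrite rR' rR rT.
Qed.

(** Now [M = T + G] for every [G] of [Y] not above [T], hence [G <= M]. Isotropy of [M = T + G0]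
    follows because [M] is spanned by isotropic spaces above [T] and so lies in [perp J T]. For [A]
    in [X], the part [A :&: G0] is not inside [T] and supplies the extra dimension of [A :&: M]. *)
Lemma full_span_C1_C2 : l = b.+1 ->
  [/\ <<M>>%MS \in Pm J b.+1, T \in subs_of <<M>>%MS t,
      X \subset C1 J <<M>>%MS T a t & Y \subset C2 J <<M>>%MS T b].
Proof.
move=> lb.
have TGM G : G \in Y -> ~~ (T <= G)%MS -> (T + G <= M)%MS.
  move=> GY nTG; have [sM rTG _ _] := span_sub GY nTG.
  by have [_ <-] := mxrank_leqif_sup sM; rewrite lb rTG.
have iG0 : tot_iso J G0 by have /PmP[] := subsetP YP _ G0Y.
have Mperp : (M <= perp J T)%MS.
  apply/sumsmx_subP => S; rewrite inE => /and3P[/PmP[_ _ iS] TS _].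
  rewrite sub_perp; apply/eqP/(form_sub (submx_refl S) TS).
  exact/tot_isoP.
have iM : tot_iso J M.
  have [sM _ _ _] := span_sub G0Y nTG0.
  apply: (tot_iso_adds HJ iT (B := G0)) => //; first exact/tot_isoP.
  by apply: submx_trans Mperp; apply: submx_trans (TGM _ G0Y nTG0); apply: addsmxSr.
split.
- by apply/PmP; rewrite genmx_subspace genmxE tot_iso_gen.
- by rewrite inE sT rT eqxx genmxE T_sub_span.
- apply/subsetP => A AX; rewrite inE (subsetP XP) //= TX //=.
  have s : (T + (A :&: G0) <= A :&: <<M>>)%MS.
    rewrite addsmx_sub !sub_capmx TX // capmxSl !genmxE T_sub_span /=.
    by apply: submx_trans (TGM _ G0Y nTG0); rewrite (submx_trans (capmxSr _ _)) ?addsmxSr.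
  apply: leq_trans (mxrankS s); rewrite -rT ltn_neqAle mxrankS ?addsmxSl // andbT.
  have [_ ->] := mxrank_leqif_sup (addsmxSl T (A :&: G0)%MS).
  rewrite addsmx_sub submx_refl /=; apply: contra nTG0 => h.
  have [_ e] := mxrank_leqif_sup h.
  have : (T <= A :&: G0)%MS by rewrite -e eqn_leq mxrankS // rT; exact: cXY.
  by rewrite sub_capmx => /andP[].
apply/subsetP => G GY; have GP := subsetP YP _ GY.
rewrite !inE; case TG: (T <= G)%MS; first by move: GP; rewrite inE => ->.
have /PmP[sG _ _] := GP; rewrite sG (rG GY) eqxx genmxE /=.
by rewrite (submx_trans _ (TGM _ GY (negbT TG))) ?addsmxSr ?orbT.
Qed.

(** A member of [Y] not above [T] contains a hyperplane of [M] not above [T], and [M] has [br l]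
    hyperplanes. *)
Lemma Y_le_span c :
  (forall H : sub, H \in subs_of M l.-1 -> ~~ (T <= H)%MS -> #|containing Y H|%:R <= c) ->
  0 <= c -> #|Y|%:R <= N t b + br l * c.
Proof.
move=> hc c0; rewrite -(cardsID [set G | (T <= G)%MS] Y) natrD; apply: lerD.
  have := containing_le HJ YP T; rewrite rT; apply: le_trans.
  by rewrite ler_nat subset_leq_card //; apply/subsetP => G; rewrite !inE.
pose HH := [set H in subs_of M l.-1 | ~~ (T <= H)%MS].
have hY G : G \in Y :\: [set G | (T <= G)%MS] -> exists2 H, H \in HH & (H <= G)%MS.
  rewrite !inE => /andP[nTG GY]; have [_ _ _ r] := span_sub GY nTG.
  exists <<M :&: G>>%MS; last by rewrite genmxE capmxSr.
  rewrite !inE genmx_subspace !genmxE r eqxx capmxSl /=.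
  by apply: contra nTG; rewrite sub_capmx => /andP[].
apply: le_trans (card_cover_le hY) _; apply: sum_le_const => //.
  have rl : l = l.-1.+1 by have := span_rank_gt; nat_lia.
  rewrite [in br _]rl -(card_subs_hyper rl) ler_nat subset_leq_card //.
  by apply/subsetP => H; rewrite inE => /andP[].
move=> H; rewrite inE => /andP[h1 h2]; apply: le_trans (hc H h1 h2).
rewrite ler_nat subset_leq_card //; apply/subsetP => G.
by rewrite !inE => /andP[/andP[_ ->] ->].
Qed.

Lemma small_span_bound : (l <= b)%N ->
  (l = t.+1 -> exists2 A, A \in X & ~~ (M <= A)%MS) ->
  2 * (#|X|%:R * #|Y|%:R) <= 3 * (br (b - t) * N t.+1 a * N t b).
Proof.
move=> lb hA; have p0 := Pnum_ge0 F nu; have tl := span_rank_gt.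
have kX : #|X|%:R <= 5 / 4 * (br (b - t) * N t.+1 a).
  apply: le_trans X_le_span _; have := X_bound_numeric F hn t0 ta tb.
  have : br (l - t) <= br (b - t) by apply: le_qint; nat_lia.
  by move/(ler_wpM2r (p0 t.+1 a)); lra.
suff kY : #|Y|%:R <= 9 / 8 * N t b.
  have := ler_pM (ler0n _ _) (ler0n _ _) kX kY.
  have := mulr_ge0 (mulr_ge0 (qint_ge0 #|F| (b - t)) (p0 t.+1 a)) (p0 t b); lra.
(* For [l > t.+1] a hyperplane of [M] already has rank at least [t.+1]. For [l = t.+1] it has rank
   only [t], and the missing step comes from a member [A] of [X] not above [M]: if [A] contained the
   hyperplane [H], it would contain [T + H = M]. So [H] is not a cover of [X]. *)
have [lt1|lt1] := eqVneq l t.+1.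
  have [A AX nMA] := hA lt1.
  have c0 : 0 <= br (a - t).+1 * N t.+1 b by rewrite mulr_ge0 ?qint_ge0.
  apply: le_trans (Y_le_span (c := br (a - t).+1 * N t.+1 b) _ c0) _.
    move=> H; rewrite inE lt1 /= => /and3P[sH /eqP rH HM] nTH.
    apply: (containing_step XP cYX (ltnW ta)) => //.
      apply/not_coverP; exists A => //; rewrite ltnNge; apply: contra nMA => h.
      have HA : (H <= A)%MS.
        have [_ e] := mxrank_leqif_sup (capmxSl H A).
        have : (H <= H :&: A)%MS by rewrite -e eqn_leq mxrankS ?capmxSl // rH.
        by rewrite sub_capmx => /andP[].
      have s1 : (T + H <= M)%MS by rewrite addsmx_sub T_sub_span.
      have r1 : (t < \rank (T + H)%MS)%N.
        rewrite -{1}rH ltn_neqAle mxrankS ?addsmxSr // andbT.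
        have [_ ->] := mxrank_leqif_sup (addsmxSr T H).
        by rewrite addsmx_sub (negbTE nTH).
      have [_ e] := mxrank_leqif_sup s1.
      have s2 : (M <= T + H)%MS by rewrite -e eqn_leq mxrankS // lt1.
      by apply: submx_trans s2 _; rewrite addsmx_sub HA TX.
    move=> R; rewrite inE => /and4P[_ /eqP rR _ _].
    by have := containing_le HJ YP R; rewrite rR rH.
  rewrite lt1 mulrA.
  by have := Y_bound_numeric (F := F) hn t0 ta tb (or_introl (erefl _)); lra.
have lt2 : (t.+1 < l)%N by rewrite ltn_neqAle eq_sym lt1.
apply: le_trans (Y_le_span (c := N t.+1 b) _ (p0 _ _)) _.
  move=> H; rewrite inE => /and3P[sH /eqP rH HM] nTH.
  apply: le_trans (containing_le HJ YP H) _.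
  by rewrite rH; apply: Pnum_mono; nat_lia.
have : br l <= br b by exact: le_qint.
move/(ler_wpM2r (p0 t.+1 b)).
by have := Y_bound_numeric (F := F) hn t0 ta tb (or_intror (erefl _)); lra.
Qed.

End CommonSubspace.

(** The size hypothesis is symmetric in [a] and [b], so that either of the two families may play the
    part of [X]. *)
Lemma common_subspace_cases (F : finFieldType) (nu : nat) (J : 'M[F]_(2 * nu))
    (X Y : {set 'M[F]_(2 * nu)}) (a b t : nat) (T : 'M[F]_(2 * nu)) :
  nondeg_alt J ->
  (a + b + maxn a b + t + 3 <= 2 * nu)%N -> (0 < t)%N -> (t < a)%N -> (t < b)%N ->
  X \subset Pm J a -> Y \subset Pm J b -> cross_int t X Y -> X != set0 ->
  T \in Pm J t -> (forall A, A \in X -> (T <= A)%MS) ->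
  (exists2 G, G \in Y & ~~ (T <= G)%MS) ->
  [\/ exists M T', [/\ M \in Pm J b.+1, T' \in subs_of M t,
        X \subset C1 J M T' a t & Y \subset C2 J M T' b],
      exists S, [/\ S \in Pm J t.+1, X \subset C3 J S a & Y \subset C4 J S b t]
    | 2 * (#|X|%:R * #|Y|%:R) <=
      3 * (qint #|F| (b - t) * Pnum F nu t.+1 a * Pnum F nu t b)].
Proof.
move=> HJ hn t0 ta tb XP YP cXY X0 TP TX [G0 G0Y nTG0].
have [no|TT0] := eqVneq (succ_covers J Y t T) set0.
  apply: Or33; have := no_succ_cover_bound HJ hn t0 ta tb XP YP cXY X0 TP TX G0Y nTG0 no.
  have := mulr_ge0 (ler0n rat #|X|) (ler0n rat #|Y|); lra.
have [_ _ lb _] := span_sub hn t0 ta tb YP TP TT0 G0Y nTG0.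
rewrite leq_eqVlt in lb; case/orP: lb => [/eqP lb|lb].
  apply: Or31; exists <<cover_span J Y t T>>%MS, T.
  exact: (full_span_C1_C2 HJ hn t0 ta tb XP YP cXY TP TX G0Y nTG0 TT0 lb).
have := small_span_bound HJ hn t0 ta tb XP YP cXY TP TX G0Y nTG0 TT0 lb.
case: (boolP [exists A in X, ~~ (cover_span J Y t T <= A)%MS]).
  by move=> /exists_inP[A AX nA] h; apply: Or33; apply: h => _; exists A.
move=> /exists_inPn hX h; case: (eqVneq (\rank (cover_span J Y t T)) t.+1) => [e|ne].
  (* Any cover [S] of rank [t.+1] will do: it lies in [M], hence in all of [X], and being a cover of
     [Y] it puts [Y] inside [C4]. *)
  apply: Or32; have /set0Pn[S SS] := TT0; exists S.
  have sM := succ_cover_span SS.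
  move: SS; rewrite inE => /and3P[SP TS cS]; split=> //.
    apply/subsetP => A AX; rewrite inE (subsetP XP) //=.
    by apply: submx_trans sM _; have := hX A AX; rewrite negbK.
  apply/subsetP => G GY; rewrite inE (subsetP YP) //= capmxC.
  by have /forall_inP := cS; apply.
by apply: Or33; apply: h => e; rewrite e eqxx in ne.
Qed.

(** * The structured pairs: cross-intersection, non-triviality and sizes *)

Section Constructions.
Variables (F : finFieldType) (nu : nat) (J : 'M[F]_(2 * nu)).
Hypothesis HJ : nondeg_alt J.
Local Notation n := (2 * nu)%N.
Local Notation sub := 'M[F]_n.
Local Notation q := #|F|.
Local Notation br := (qint #|F|).
Local Notation N := (Pnum F nu).
Let q1 := card_F_gt1 F.

Lemma lt_qint x y : (x < y)%N -> br x < br y.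
Proof.
move=> lt; apply: lt_le_trans (le_qint _ lt).
by rewrite qintS; have := qint_ge0 q x; have := qR_ge2 q1; nra.
Qed.

Lemma Pnum_lt s m : (s < m)%N -> (m <= nu)%N -> N s.+1 m < N s m.
Proof.
move=> sm mn; have b0 : 0 < br (m - s) by rewrite qint_gt0 // subn_gt0.
rewrite -(ltr_pM2r b0) PnumS; last by lia.
by rewrite mulrC ltr_pM2r ?Pnum_gt0 // lt_qint //; lia.
Qed.

Lemma C1_Pm (M T : sub) a t : C1 J M T a t \subset Pm J a.
Proof. by apply/subsetP => A; rewrite inE => /andP[]. Qed.

Lemma C2_Pm (M T : sub) b : tot_iso J M -> C2 J M T b \subset Pm J b.
Proof.
move=> iM; apply/subsetP => A; rewrite in_setU => /orP[].
  by rewrite inE => /andP[].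
rewrite inE => /and3P[sA /eqP rA AM]; apply/PmP; split=> //.
exact: tot_iso_sub AM.
Qed.

Lemma C3_Pm (S : sub) a : C3 J S a \subset Pm J a.
Proof. by apply/subsetP => A; rewrite inE => /andP[]. Qed.

Lemma C4_Pm (S : sub) b t : C4 J S b t \subset Pm J b.
Proof. by apply/subsetP => A; rewrite inE => /andP[]. Qed.

Lemma C1_C2_cross (M T : sub) a b t : \rank M = b.+1 -> \rank T = t ->
  cross_int t (C1 J M T a t) (C2 J M T b).
Proof.
move=> rM rT A B; rewrite inE => /and3P[_ TA tAM]; rewrite in_setU => /orP[].
  by rewrite inE => /andP[_ TB]; rewrite -rT mxrankS // sub_capmx TA.
rewrite inE => /and3P[_ /eqP rB BM].
by have := rank_cap_ge A BM; rewrite rM rB; lia.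
Qed.

Lemma C3_C4_cross (S : sub) a b t : cross_int t (C3 J S a) (C4 J S b t).
Proof.
move=> A B; rewrite !inE => /andP[_ SA] /andP[_ tB].
by apply: leq_trans tB _; rewrite mxrankS // capmxC capmxS.
Qed.

(** A common [T0] would lie in all [br b.+1] hyperplanes of [M], while only [br (b.+1 - \rank T0)]
    contain it. *)
Lemma C2_no_common (M T T0 : sub) b : \rank M = b.+1 -> (0 < \rank T0)%N ->
  ~ (forall A, A \in C2 J M T b -> (T0 <= A)%MS).
Proof.
move=> rM t0 h; have h' A : A \in subs_of M b -> (T0 <= A)%MS.
  by move=> AM; apply: h; rewrite in_setU AM orbT.
have c := card_subs_hyper rM.
have TM : (T0 <= M)%MS.
  have : (0 : rat) < #|subs_of M b|%:R by rewrite c qint_gt0.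
  rewrite ltr0n card_gt0 => /set0Pn[A AM]; apply: submx_trans (h' A AM) _.
  by move: AM; rewrite inE => /and3P[].
have := card_hyperplanes_above TM rM.
rewrite (_ : [set _ in _ | _] = subs_of M b).
  by rewrite c => /eqP; rewrite gt_eqF // lt_qint //; lia.
by apply/setP => A; rewrite in_set; case AM: (A \in subs_of M b); rewrite // h'.
Qed.

(** Every [t]-subspace [H] of [S] has all isotropic [b]-spaces above it in [C4]. If they all
    contained [T0], counting those above [H] and above [H + T0] would force [H = T0]; but [S] has
    more than one such [H]. *)
Lemma C4_no_common (S T0 : sub) b t : S \in Pm J t.+1 -> T0 \in Pm J t ->
  (0 < t)%N -> (t < b)%N -> (b <= nu)%N ->
  ~ (forall A, A \in C4 J S b t -> (T0 <= A)%MS).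
Proof.
move=> /PmP[sS rS iS] /PmP[sT rT iT] t0 tb bn h.
suff sub1 : subs_of S t \subset [set T0].
  have := subset_leq_card sub1; rewrite cards1 -(ler_nat rat) (card_subs_hyper rS).
  have : br 1 < br t.+1 by apply: lt_qint.
  by rewrite qint1; lra.
apply/subsetP => H; rewrite !inE => /and3P[sH /eqP rH HS].
have iH : tot_iso J H := tot_iso_sub iS HS.
have le : #|above J b H|%:R <= (#|above J b (H + T0)%MS|%:R : rat).
  rewrite ler_nat subset_leq_card //; apply/subsetP => A.
  rewrite !inE => /andP[AP HA]; rewrite AP addsmx_sub HA /= h // inE.
  by rewrite inE AP -rH mxrankS // sub_capmx HA.
have {}le := le_trans le (card_above_le HJ _ _).
rewrite (card_above HJ _ iH) rH in le.
have [rHT|rHT] := leqP (\rank (H + T0)%MS) t.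
  apply/eqP/esym/subspace_eq => //; last by rewrite rH rT.
  have [_ e] := mxrank_leqif_sup (addsmxSl H T0).
  have : (H + T0 <= H)%MS by rewrite -e eqn_leq mxrankS ?addsmxSl // rH.
  by rewrite addsmx_sub => /andP[].
have := Pnum_lt tb bn; have := Pnum_mono F rHT bn; lra.
Qed.

Lemma card_C3 (S : sub) a t : S \in Pm J t.+1 -> #|C3 J S a|%:R = N t.+1 a.
Proof. by move=> /PmP[_ rS iS]; rewrite -rS -(card_above HJ _ iS). Qed.

(** Count pairs of a [t]-subspace of [S] and a member above it: a member above [S] contains all
    [br t.+1] of these subspaces, any other member exactly one, its intersection with [S]. *)
Lemma card_C4 (S : sub) b t : S \in Pm J t.+1 ->
  #|C4 J S b t|%:R = br t.+1 * N t b - (br t.+1 - 1) * N t.+1 b.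
Proof.
move=> /PmP[sS rS iS].
have := double_count (C4 J S b t) (subs_of S t) (fun G H => (H <= G)%MS).
move=> /(congr1 (fun x => x%:R : rat)); rewrite !natr_sum.
rewrite [X in _ = X](eq_bigr (fun=> N t b)); last first.
  move=> H; rewrite inE => /and3P[sH /eqP rH HS].
  rewrite -{2}rH -(card_above HJ _ (tot_iso_sub iS HS)); congr (_ %:R).
  apply: eq_card => G; rewrite !inE -!andbA; case HG: (H <= G)%MS; rewrite ?andbF //.
  by rewrite -{1}rH mxrankS ?sub_capmx ?HG.
rewrite sumr_const -[N t b *+ _]mulr_natl (card_subs_hyper rS).
rewrite (bigID (fun G => S <= G)%MS) /=.
have e1 : \sum_(G in C4 J S b t | (S <= G)%MS)
    #|[set H in subs_of S t | (H <= G)%MS]|%:R = br t.+1 * N t.+1 b.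
  rewrite (eq_bigr (fun=> br t.+1)).
    rewrite sumr_const -[br t.+1 *+ _]mulr_natl mulrC -rS -(card_above HJ _ iS) rS.
    congr (_ * _%:R); apply: eq_card => G; rewrite unfold_in !inE -!andbA.
    case SG: (S <= G)%MS; rewrite ?andbF //.
    have -> : (t <= \rank (G :&: S)%MS)%N; last by rewrite !andbT.
    by apply: (@leq_trans (\rank S)); rewrite ?rS // -{1}rS mxrankS // sub_capmx SG /=.
  move=> G /andP[_ SG]; rewrite -(card_subs_hyper rS); congr (_ %:R).
  apply: eq_card => H; rewrite !inE; case HS: (H <= S)%MS; rewrite ?andbF //.
  by rewrite (submx_trans HS SG) andbT.
rewrite e1 (eq_bigr (fun=> 1)); last first.
  move=> G /andP[]; rewrite !inE => /andP[/and3P[sG _ _] tG] nSG.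
  have rGS : \rank (G :&: S)%MS = t.
    apply/eqP; rewrite eqn_leq tG andbT -ltnS -rS ltn_neqAle mxrankS ?capmxSr // andbT.
    have [_ ->] := mxrank_leqif_sup (capmxSr G S).
    by apply: contra nSG; rewrite sub_capmx => /andP[].
  have -> : [set H in subs_of S t | (H <= G)%MS] = [set <<(G :&: S)%MS>>%MS].
    apply/setP => H; rewrite !inE; apply/andP/eqP => [[/and3P[sH /eqP rH HS] HG]|->].
      apply: subspace_eq => //; rewrite ?genmx_subspace ?genmxE ?rGS ?rH //.
      by rewrite sub_capmx HG.
    by rewrite genmx_subspace !genmxE rGS eqxx capmxSr capmxSl.
  by rewrite cards1.
rewrite sumr_const.
have : #|C4 J S b t|%:R = N t.+1 b +
   #|[pred G in C4 J S b t | ~~ (S <= G)%MS]|%:R :> rat.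
  rewrite -sum1_card natr_sum (bigID (fun G => S <= G)%MS) /=; congr (_ + _).
    rewrite sumr_const -rS -(card_above HJ _ iS); congr (_%:R).
    apply: eq_card => G; rewrite unfold_in !inE -!andbA; case SG: (S <= G)%MS; rewrite ?andbF //.
    have -> : (t <= \rank (G :&: S)%MS)%N; last by rewrite !andbT.
    by apply: (@leq_trans (\rank S)); rewrite ?rS // -{1}rS mxrankS // sub_capmx SG /=.
  by rewrite sumr_const.
move=> -> H; have : N t.+1 b + (br t.+1 * N t b - br t.+1 * N t.+1 b) = 
   N t.+1 b + #|[pred G in C4 J S b t | ~~ (S <= G)%MS]|%:R.
  by rewrite -H; ring.
by move=> <-; ring.
Qed.

Lemma card_C2 (M T : sub) b t : M \in Pm J b.+1 -> T \in subs_of M t ->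
  #|C2 J M T b|%:R = N t b + (br b.+1 - br (b.+1 - t)).
Proof.
move=> /PmP[sM rM iM]; rewrite inE => /and3P[sT /eqP rT TM].
have iT := tot_iso_sub iM TM.
have e : C2 J M T b = above J b T :|: (subs_of M b :\: [set H | (T <= H)%MS]).
  apply/setP => A; rewrite !in_setU in_setD !inE.
  case TA: (T <= A)%MS; rewrite ?andbF ?andbT ?orbF //=.
  apply/orP/idP => [[//|/and3P[-> -> AM]]|->]; last by left.
  by rewrite (tot_iso_sub iM AM).
rewrite e cardsU disjoint_setI0 ?cards0 ?subn0; last first.
  rewrite -setI_eq0; apply/eqP/setP => A; rewrite !inE.
  by case: (T <= A)%MS; rewrite ?andbF ?andbT.
rewrite natrD (card_above HJ _ iT) rT; congr (_ + _).
rewrite -(card_subs_hyper rM) -(cardsID [set H | (T <= H)%MS] (subs_of M b)) natrD.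
rewrite -rT -(card_hyperplanes_above TM rM).
have -> : [set A in subs_of M b | (T <= A)%MS] = subs_of M b :&: [set H | (T <= H)%MS].
  by apply/setP => A; rewrite !inE.
by rewrite [X in _ = X - _]addrC addrK.
Qed.

Section CountC1.
Variables (M T : sub) (a b t : nat).
Hypotheses (MP : M \in Pm J b.+1) (TM : T \in subs_of M t).
Hypotheses (tb : (t < b)%N).

Let rM : \rank M = b.+1. Proof. by have /PmP[] := MP. Qed.
Let iM : tot_iso J M. Proof. by have /PmP[] := MP. Qed.
Let rT : \rank T = t. Proof. by move: TM; rewrite inE => /and3P[_ /eqP]. Qed.
Let sTM : (T <= M)%MS. Proof. by move: TM; rewrite inE => /and3P[]. Qed.

Local Notation k := (b.+1 - t)%N.
Local Notation PP := (ext T M).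
(** [C1] is the union of the families above the extensions of [T] in [M], and [c] is the
    multiplicity of a member in this union. *)
Let c (A : sub) : rat := #|[set S in PP | (S <= A)%MS]|%:R.

Let PP_iso (S : sub) : S \in PP -> tot_iso J S.
Proof. by rewrite inE => /and4P[_ _ _ /(tot_iso_sub iM)]. Qed.

Let PP_rank (S : sub) : S \in PP -> \rank S = t.+1.
Proof. by rewrite inE rT => /and4P[_ /eqP]. Qed.

Let card_PP : #|PP|%:R = br k :> rat.
Proof. by rewrite card_ext // rM rT. Qed.

Let cE A : A \in C1 J M T a t -> exists2 d, (0 < d)%N & c A = br d.
Proof.
rewrite inE => /and3P[_ TA tA]; exists (\rank (A :&: M)%MS - t)%N.
  by rewrite subn_gt0.
rewrite -rT -card_ext; last by rewrite sub_capmx TA.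
congr (_ %:R); apply: eq_card => S; rewrite !inE sub_capmx -!andbA.
by do 3![case: (_ <= _)%MS => //=; rewrite ?andbF //].
Qed.

Let above_C1 (S : sub) : S \in PP -> above J a S \subset C1 J M T a t.
Proof.
move=> SP; apply/subsetP => A; rewrite !inE => /andP[-> SA] /=.
have rS := PP_rank SP; move: SP; rewrite inE => /and4P[_ _ TS SM].
by rewrite (submx_trans TS SA) -rS mxrankS // sub_capmx SA.
Qed.

Let in_C1_above A (S : sub) : S \in PP ->
  (A \in C1 J M T a t) && (S <= A)%MS = (A \in above J a S).
Proof.
move=> SP; apply/andP/idP => [[AC SA]|h].
  by rewrite inE SA (subsetP (C1_Pm M T a t) _ AC).
by rewrite (subsetP (above_C1 SP) _ h); move: h; rewrite inE => /andP[].
Qed.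

Let sum_c : \sum_(A in C1 J M T a t) c A = br k * N t.+1 a.
Proof.
rewrite -natr_sum (double_count _ _ (fun A S => (S <= A)%MS)) natr_sum.
rewrite (eq_bigr (fun=> N t.+1 a)).
  by rewrite sumr_const -[N _ _ *+ _]mulr_natl card_PP.
move=> S SP; rewrite -(PP_rank SP) -(card_above HJ _ (PP_iso SP)).
congr (_ %:R); apply: eq_card => A; rewrite -(in_C1_above A SP); exact: in_set.
Qed.

(** Another extension of [T] in [M] spans with [S] an isotropic space of rank [t.+2], so each of the
    remaining [br k - 1] extensions contributes [N t.+2 a]. *)
Let sum_c_above (S : sub) : S \in PP ->
  \sum_(A in above J a S) (c A - 1) = (br k - 1) * N t.+2 a.
Proof.
move=> SP; rewrite big_split /= sumrN sumr_const.
rewrite (card_above HJ _ (PP_iso SP)) (PP_rank SP).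
rewrite -natr_sum (double_count _ _ (fun A S => (S <= A)%MS)) natr_sum.
rewrite (bigD1 S) //= addrC.
have -> : #|[set A in above J a S | (S <= A)%MS]|%:R = N t.+1 a :> rat.
  rewrite -(PP_rank SP) -(card_above HJ _ (PP_iso SP)); congr (_ %:R).
  by apply: eq_card => A; rewrite !inE -andbA andbb.
rewrite addrA addNr add0r (eq_bigr (fun=> N t.+2 a)).
  rewrite sumr_const -[N _ _ *+ _]mulr_natl; congr (_ * _).
  have := cardsD1 S PP; rewrite SP -card_PP => ->.
  rewrite natrD [X in _ = X - 1]addrC addrK; congr (_ %:R); apply: eq_card => S'.
  by rewrite unfold_in in_setD1 andbC.
move=> S' /andP[S'P ne]; have i1 := PP_iso S'P.
have [rS rS'] := (PP_rank SP, PP_rank S'P).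
move: (SP) (S'P); rewrite !inE => /and4P[s1 _ TS SM] /and4P[s2 _ TS' S'M].
have sM : (S + S' <= M)%MS by rewrite addsmx_sub SM.
have r : \rank (S + S')%MS = t.+2.
  have := mxrank_sum_cap S S'; rewrite rS rS'.
  have : (t <= \rank (S :&: S')%MS)%N by rewrite -rT mxrankS // sub_capmx TS.
  have : (\rank S < \rank (S + S')%MS)%N.
    rewrite ltn_neqAle mxrankS ?addsmxSl // andbT.
    have [_ ->] := mxrank_leqif_sup (addsmxSl S S').
    apply: contra ne; rewrite addsmx_sub submx_refl /= => h; apply/eqP.
    by apply: subspace_eq => //; rewrite rS rS'.
  by rewrite rS; nat_lia.
rewrite -r -(card_above HJ _ (tot_iso_sub iM sM)); congr (_ %:R).
by apply: eq_card => A; rewrite !inE addsmx_sub -!andbA.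
Qed.

(** The excess of the sum of [c] over the size of [C1] is the sum of [c A - 1]; keeping only the
    members above one fixed [S] bounds it from below. *)
Lemma C1_upper : (t < a)%N ->
  #|C1 J M T a t|%:R <= br k * N t.+1 a - (br k - 1) * N t.+2 a.
Proof.
move=> ta; have : 0 < (#|PP|%:R : rat) by rewrite card_PP qint_gt0 // subn_gt0; nat_lia.
rewrite ltr0n card_gt0 => /set0Pn[S SP].
rewrite -sum_c -(sum_c_above SP) -sum1_card natr_sum lerBrDr.
have -> : \sum_(A in C1 J M T a t) c A =
    \sum_(A in C1 J M T a t) 1%:R + \sum_(A in C1 J M T a t) (c A - 1).
  by rewrite -big_split; apply: eq_bigr => A _; rewrite /= addrC subrK.
rewrite lerD2l [leRHS](big_setID (above J a S)) /=.
have /setIidPr -> := above_C1 SP.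
rewrite lerDl; apply: sumr_ge0 => A /setDP[/cE[d d0 ->] _].
by have := qint_ge1 q1 d0; lra.
Qed.

(* Second Bonferroni inequality: [1 >= [d] - q * binom(d, 2)_q] for [d >= 1] *)
Lemma C1_lower :
  br k * N t.+1 a - br k * (br k - 1) / (q%:R + 1) * N t.+2 a
  <= #|C1 J M T a t|%:R.
Proof.
have q0 : 0 < (q%:R + 1 : rat) by have := qR_ge2 q1; lra.
have sum_cc : \sum_(A in C1 J M T a t) c A * (c A - 1) = br k * (br k - 1) * N t.+2 a.
  transitivity (\sum_(A in C1 J M T a t) \sum_(S in PP | (S <= A)%MS) (c A - 1)).
    apply: eq_bigr => A _; rewrite sumr_const -[RHS]mulr_natl; congr (_ %:R * _).
    by apply: eq_card => S; rewrite in_set.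
  rewrite (exchange_big_dep (mem PP)) /=; last by move=> A S _ /andP[].
  rewrite (eq_bigr (fun=> (br k - 1) * N t.+2 a)).
    by rewrite sumr_const -[_ *+ _]mulr_natl card_PP mulrA.
  move=> S SP; rewrite -(sum_c_above SP); apply: eq_bigl => A.
  by rewrite SP andTb in_C1_above.
rewrite -sum_c mulrAC -sum_cc mulr_suml -sumrB -sum1_card natr_sum.
apply: ler_sum => A /cE[d d0 ->]; rewrite lerBlDr -lerBlDl.
rewrite ler_pdivlMr //; case: d d0 => // d _; rewrite !qintS.
have q2 := qR_ge2 q1; case: d => [|d].
  by rewrite qint0 mulr0 add0r subrr mul0r mulr0.
rewrite qintS; have x0 := qint_ge0 q d; set x := br d in x0 *.
have y0 : 0 <= q%:R * (q%:R * x) by rewrite !mulr_ge0 //; lra.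
by rewrite [leRHS]mulrC ler_wpM2l //; lra.
Qed.

End CountC1.

End Constructions.

(** The comparison for [b = 2 t] in terms of rational numbers. Here [u = q]; [tau], [x], [w] are
    [br t.+1], [br t], [br t.-1]; [y] is [br (a - t.+1)]; [Ai] and [Bi] are [N (t + i) a] and
    [N (t + i) b]; [Q] and [Q2] are [br (n - 2 * t)] and [br (n - 2 * t.+1)]; [E] counts the
    hyperplanes of [M] not above [T], and [e = br b.+1]. *)
Lemma tie_arith (u tau x w y A1 A2 B0 B1 B2 Q Q2 e E : rat) :
  B0 * x = Q * B1 -> B1 * w = Q2 * B2 -> A1 * y = Q2 * A2 ->
  tau = u * x + 1 -> x = u * w + 1 -> 1 <= w -> w <= y -> 1 <= B2 -> 0 < A1 ->
  0 <= A2 -> u ^+ 2 * Q2 <= Q -> 4 * (e * x * w) <= Q2 -> 0 <= E -> E <= e ->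
  0 < Q2 -> 0 < Q -> 2 <= u -> 0 < B0 -> 0 < B1 ->
  (tau * A1 - (tau - 1) * A2) * (B0 + E) < A1 * (tau * B0 - (tau - 1) * B1).
Proof.
move=> R1b R2b R2a et et1 w1 yw B2p A1p A2p QQ Q2big E0 Ele Q2p Qp u2 B0p B1p.
have w0 : 0 < w by lra.
have u0 : 0 < u by lra.
have x1' : 1 <= x by rewrite et1; nra.
have x0 : 0 < x by lra.
have e0 : 0 <= e by lra.
have B1big : 4 * (e * x) <= B1.
  rewrite -(ler_pM2r w0) R2b; have := ler_wpM2l (ltW Q2p) B2p; lra.
(* relative losses: [u x y / Q2] for C1 against [u x ^ 2 / Q] for C4 *)
have loss : Q2 * x + Q2 <= y * Q.
  have h : y * (u ^+ 2 * Q2) <= y * Q by apply: ler_wpM2l QQ; lra.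
  have h2 : w * (u ^+ 2 * Q2) <= y * (u ^+ 2 * Q2).
    by apply: ler_wpM2r yw; apply: mulr_ge0; [exact: sqr_ge0|exact: ltW].
  have h3 : (x + 1) * Q2 <= w * u ^+ 2 * Q2.
    apply: ler_wpM2r; first exact: ltW.
    have g1 := ler_wpM2r (ltW w0) u2.
    have g2 := ler_wpM2r (mulr_ge0 (ltW u0) (ltW w0)) u2.
    by rewrite et1 expr2; lra.
  lra.
(* The common leading term [tau * A1 * B0] cancels and [tau - 1 = u * x]. The loss of [C1] must
   outweigh the loss of [C4] together with the gain [E] of [C2]. *)
suff key : tau * A1 * E + u * x * B1 * A1 < u * x * A2 * B0.
  have P : 0 <= u * x * A2 * E by rewrite !mulr_ge0 // ltW.
  by rewrite et in key *; lra.
rewrite -(ltr_pM2r Q2p) -(ltr_pM2r Qp).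
have -> : u * x * A2 * B0 * Q2 * Q = u * x * B0 * A1 * (y * Q).
  have -> : u * x * A2 * B0 * Q2 * Q = u * x * B0 * (Q2 * A2) * Q by ring.
  by rewrite -R2a; ring.
have -> : (tau * A1 * E + u * x * B1 * A1) * Q2 * Q =
   tau * A1 * E * Q2 * Q + u * x * B0 * A1 * (Q2 * x).
  have -> : u * x * B0 * A1 * (Q2 * x) = u * x * A1 * Q2 * (B0 * x) by ring.
  by rewrite R1b; ring.
have P : 0 < u * x * B0 * A1 by rewrite !mulr_gt0.
apply: lt_le_trans (ler_wpM2l (ltW P) loss).
rewrite mulrDr [ltRHS]addrC ltrD2r.
have PQ : 0 < A1 * Q2 by rewrite mulr_gt0.
(* [loss] leaves one spare [Q2], which only has to absorb the term with [E]; multiplied by [x], this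
   follows from [B0 * x = Q * B1] and [B1big]. *)
suff : tau * E * Q < u * x * B0 by rewrite -(ltr_pM2r PQ); lra.
rewrite -(ltr_pM2r x0) -[ltRHS]mulrA R1b.
have h0 : 1 <= u * x by nra.
have h1 : tau <= 2 * (u * x) by rewrite et; lra.
have h2 : tau * E * Q * x <= 2 * (u * x) * e * Q * x.
  do 2![apply: ler_wpM2r; first exact: ltW].
  by apply: ler_pM => //; rewrite et; lra.
have h3 := ler_wpM2l (mulr_ge0 (mulr_ge0 (ltW u0) (ltW Qp)) (ltW x0)) B1big.
have h4 : 0 < u * x * Q * B1 by rewrite !mulr_gt0.
lra.
Qed.

(** * Comparing the sizes of the structured pairs *)

Section Comparisons.
Variables (F : finFieldType) (nu : nat).
Local Notation n := (2 * nu)%N.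
Local Notation q := #|F|.
Local Notation br := (qint #|F|).
Local Notation N := (Pnum F nu).
Let q1 := card_F_gt1 F.
Let q2 : 2 <= q%:R :> rat. Proof. exact: qR_ge2. Qed.

Definition C12_lower (a b t : nat) : rat :=
  let k := (b.+1 - t)%N in
  (br k * N t.+1 a - br k * (br k - 1) / (q%:R + 1) * N t.+2 a)
  * (N t b + (br b.+1 - br k)).

Definition C12_upper (a b t : nat) : rat :=
  let k := (b.+1 - t)%N in
  (br k * N t.+1 a - (br k - 1) * N t.+2 a) * (N t b + (br b.+1 - br k)).

Definition C34_size (a b t : nat) : rat :=
  N t.+1 a * (br t.+1 * N t b - (br t.+1 - 1) * N t.+1 b).

Variables (a b t : nat).
Hypotheses (ba : (b <= a)%N) (t0 : (0 < t)%N) (tb : (t < b)%N).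
Hypothesis hn : (2 * a + b + t + 3 <= n)%N.

Let hn' : (a + b + maxn a b + t + 3 <= n)%N. Proof. lia. Qed.
Let ta : (t < a)%N. Proof. lia. Qed.
Let anu : (a <= nu)%N. Proof. lia. Qed.
Let bnu : (b <= nu)%N. Proof. lia. Qed.
Let p0 := Pnum_ge0 F nu.
Let b0 := qint_ge0 q.

Let kE m : (t < m)%N -> br (m.+1 - t) = q%:R * br (m - t) + 1.
Proof. by move=> tm; rewrite subSn ?qintS // ltnW. Qed.

Let x1 m : (t < m)%N -> 1 <= br (m - t).
Proof. by move=> tm; apply: qint_ge1 => //; rewrite subn_gt0. Qed.

Let N_ge1 s m : (s <= m)%N -> (m <= nu)%N -> 1 <= N s m.
Proof. by move=> sm mn; rewrite -[1](Pnum_id F nu m); apply: Pnum_mono. Qed.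

Let R1 m : (m <= nu)%N -> (t < m)%N -> N t m * br (m - t) = br (n - 2 * t) * N t.+1 m.
Proof. by move=> mn tm; apply: PnumS; lia. Qed.

Let R2 m : (m <= nu)%N -> (t < m)%N ->
  N t.+1 m * br (m - t.+1) = br (n - 2 * t.+1) * N t.+2 m.
Proof. by move=> mn tm; apply: PnumS; lia. Qed.

Lemma Pnum_swap : br (b - t) * N t b * N t.+1 a = br (a - t) * N t a * N t.+1 b.
Proof. have := R1 bnu tb; have := R1 anu ta; rewrite ![_ * br _]mulrC => -> ->; ring. Qed.

Let C1_loss_le :
  br (b.+1 - t) * (br (b.+1 - t) - 1) / (q%:R + 1) * N t.+2 a <=
  br (b.+1 - t) * br (b - t) * N t.+2 a.
Proof.
apply: ler_wpM2r => //; rewrite -mulrA; apply: ler_wpM2l => //.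
rewrite ler_pdivrMr; last by have := q2; lra.
by rewrite kE //; have := b0 (b - t); lra.
Qed.

Let E_ge0 m : (t <= m)%N -> 0 <= br m.+1 - br (m.+1 - t).
Proof. by move=> tm; rewrite subr_ge0; apply: le_qint; lia. Qed.

(** [br (b.+1 - t)] is at least [2 * br (b - t) + 1], and the overlap correction costs at most a
    quarter of [br (b - t) * N t.+1 a]; so a factor above 7/4 remains. *)
Lemma C12_lower_gt :
  3 * (br (b - t) * N t.+1 a * N t b) < 2 * C12_lower a b t.
Proof.
rewrite /C12_lower; have := X_bound_numeric F hn' t0 ta tb; have := C1_loss_le.
rewrite -subSn ?(ltnW tb) //; set K := br (b.+1 - t); set L := _ / _ * _ => hL hX.
have Ke := kE tb; rewrite -/K in Ke; have xx := x1 tb.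
set x := br (b - t) in hL hX Ke xx *.
have Kx : 2 * x + 1 <= K by move: q2; rewrite Ke; nra.
have P1 := N_ge1 ta anu; have P2 := p0 t.+2 a; have P3 := N_ge1 (ltnW tb) bnu.
have E0 := E_ge0 (ltnW tb); rewrite -/K in E0.
set E := br b.+1 - K in E0 *.
move: P1 P2 P3 hL hX; set A1 := N t.+1 a; set A2 := N t.+2 a; set B0 := N t b.
move=> P1 P2 P3 hL hX.
have h1 : K * x * A2 <= K ^+ 2 * A2.
  by apply: ler_wpM2r => //; rewrite expr2; apply: ler_wpM2l; lra.
have h2 : (2 * x + 1) * A1 <= K * A1 by apply: ler_wpM2r => //; lra.
have h3 : 3 / 2 * (x * A1) < K * A1 - L.
  have : 0 < x * A1 by apply: mulr_gt0; lra.
  lra.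
have h4 : 3 / 2 * (x * A1) * B0 < (K * A1 - L) * B0 by rewrite ltr_pM2r //; lra.
have xA : 0 <= x * A1 by apply: mulr_ge0; lra.
have h5 : 0 <= (K * A1 - L) * E by apply: mulr_ge0 => //; lra.
by rewrite mulrDr; lra.
Qed.

Let Nb1_le : 8 * N t.+1 b <= N t b.
Proof.
have := Y_bound_numeric hn' t0 ta tb (or_intror (erefl (br b))).
have : 1 <= br b by apply: qint_ge1 => //; lia.
by move/(ler_wpM2r (p0 t.+1 b)); lra.
Qed.

Let E_le : 4 * br b.+1 <= N t b.
Proof.
have x0 : 0 < br (b - t) by have := x1 tb; lra.
rewrite -(ler_pM2r x0) R1 //; apply: (@le_trans _ _ (br (n - 2 * t))).
  apply: (@le_trans _ _ (br (b.+1 + (b - t) + 2))); last by apply: le_qint; lia.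
  have -> : 4 = 2 ^+ 2 :> rat by ring.
  by apply: le_trans (qint_pow2 q1 _ _); rewrite -mulrA ler_pM2l // qintM.
by rewrite ler_peMr // N_ge1.
Qed.

Lemma C34_le : C34_size a b t <= N t.+1 a * (br t.+1 * N t b).
Proof.
rewrite /C34_size ler_wpM2l // lerBlDr lerDl mulr_ge0 // subr_ge0.
by rewrite qint_ge1.
Qed.

Lemma C34_ge : 7 / 8 * (N t.+1 a * (br t.+1 * N t b)) <= C34_size a b t.
Proof.
rewrite /C34_size.
have h1 : (br t.+1 - 1) * N t.+1 b <= br t.+1 * N t.+1 b.
  by rewrite mulrBl mul1r lerBlDr lerDl.
have h2 := ler_wpM2l (b0 t.+1) Nb1_le.
have h3 : 7 / 8 * (br t.+1 * N t b) <= br t.+1 * N t b - (br t.+1 - 1) * N t.+1 b.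
  by lra.
by have := ler_wpM2l (p0 t.+1 a) h3; lra.
Qed.

(** For [b > 2 t] one has [br t.+1 <= br (b - t)], so the pair ([C3], [C4]) does not even exceed
    D. *)
Lemma C34_lt_C12_large : (2 * t < b)%N -> C34_size a b t < C12_lower a b t.
Proof.
move=> tb2; have h1 := C34_le; have h2 := C12_lower_gt.
have h3 : br t.+1 <= br (b - t) by apply: le_qint; lia.
have P : 0 <= N t.+1 a * N t b by rewrite mulr_ge0.
by have := ler_wpM2r P h3; have := mulr_ge0 (b0 (b - t)) P; lra.
Qed.

(** By [Pnum_swap] the leading terms have ratio [br (b - t) / br (a - t)], at most 1/2, while the
    unswapped size keeps 7/8 of its leading term. *)
Lemma C34_lt_C34 : (b < a)%N -> C34_size b a t < C34_size a b t.
Proof.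
move=> ltba.
apply: (@lt_le_trans _ _ (7 / 8 * (N t.+1 a * (br t.+1 * N t b)))); last exact: C34_ge.
apply: (@le_lt_trans _ _ (N t.+1 b * (br t.+1 * N t a))).
  rewrite /C34_size ler_wpM2l // lerBlDr lerDl mulr_ge0 // subr_ge0.
  by rewrite qint_ge1.
have x'0 : 0 < br (a - t) by have := x1 ta; lra.
rewrite -(ltr_pM2r x'0).
have -> : N t.+1 b * (br t.+1 * N t a) * br (a - t) =
    br t.+1 * (br (b - t) * N t b * N t.+1 a) by rewrite Pnum_swap; ring.
have xx : 2 * br (b - t) <= br (a - t).
  by apply: le_trans (qint_double q1 _) _; apply: le_qint; lia.
have P : 0 < N t.+1 a * br t.+1 * N t b.
  by rewrite !mulr_gt0 ?Pnum_gt0 ?qint_gt0 // ltnW.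
have := ler_wpM2r (ltW P) xx; have : 0 < N t.+1 a * br t.+1 * N t b * br (a - t).
  exact: mulr_gt0.
lra.
Qed.

(** Put [x = br (b - t)] and [x' = br (a - t)]. After multiplication by [x * x'] and [Pnum_swap],
    the leading terms are [(q x' + 1) x] and [(q x + 1) x'] times the same number, so the margin is
    only [x' - x]. As [x' >= 2 x + 1], this exceeds [x' / 2], which is shared equally by the loss of
    [C1] and the extra hyperplanes in [C2]. *)
Lemma C12_lt_C12 : (b < a)%N -> C12_upper b a t < C12_lower a b t.
Proof.
move=> ltba; rewrite /C12_upper /C12_lower.
have hL := C1_loss_le; move: hL.
set K := br (b.+1 - t); set K' := br (a.+1 - t); set L := _ / _ * _ => hL.
have Ke := kE tb; have K'e := kE ta; rewrite -/K in Ke; rewrite -/K' in K'e.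
have xx := x1 tb; have xx' := x1 ta; have swp := Pnum_swap.
have E0 := E_ge0 (ltnW tb); have E'0 := E_ge0 (ltnW ta); rewrite -/K -/K' in E0 E'0.
have hx : 2 * br (b - t) + 1 <= br (a - t).
  apply: (@le_trans _ _ (br (b - t).+1)); last by apply: le_qint; nat_lia.
  by rewrite qintS; move: (b0 (b - t)) q2; nra.
have A2 := N_ge1 ltba anu.
have A2' : 1 <= N t.+2 a by apply: N_ge1 => //; nat_lia.
have h2 : 4 * (K * br (b - t) * N t.+2 a) <= N t.+1 a.
  have y0 : 0 < br (a - t.+1) by rewrite qint_gt0 //; nat_lia.
  rewrite -(ler_pM2r y0) R2 //.
  have h : br (b.+1 - t) * br (b - t) * br (a - t.+1) * br 2 * 2 <= br (n - 2 * t.+1).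
    rewrite mulrC; apply: (@le_trans _ _ (br ((b.+1 - t) + (b - t) + (a - t.+1) + 2 + 1))).
      have := qint_pow2 q1 1 (b.+1 - t + (b - t) + (a - t.+1) + 2).
      rewrite expr1; apply: le_trans; rewrite ler_pM2l //.
      exact: qint_prod4.
    by apply: le_qint; nat_lia.
  have q3 : 2 <= br 2 by have := q2; rewrite qint2; lra.
  have P : 0 <= br (b.+1 - t) * br (b - t) * br (a - t.+1) by rewrite !mulr_ge0.
  have {}h := le_trans (ler_wpM2r (ler0n _ 2) (ler_wpM2l P q3)) h.
  by have := ler_wpM2r (p0 t.+2 a) h; rewrite -/K; lra.
have h1 : 4 * (br 2 * br (b - t) * br a.+1) <= N t a.
  have x0 : 0 < br (a - t) * br (a - t.+1) by rewrite mulr_gt0 // qint_gt0 //; nat_lia.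
  rewrite -(ler_pM2r x0) [N t a * _]mulrA R1 // -[_ * _ * br (a - t.+1)]mulrA R2 //.
  apply: (@le_trans _ _ (br (n - 2 * t) * br (n - 2 * t.+1))); last first.
    by rewrite mulrA ler_peMr // mulr_ge0.
  apply: ler_pM; rewrite ?mulr_ge0 //.
    apply: (@le_trans _ _ (br (2 + (b - t) + a.+1 + 2))); last by apply: le_qint; nat_lia.
    have -> : 4 = 2 ^+ 2 :> rat by ring.
    apply: le_trans (qint_pow2 q1 _ _); rewrite ler_pM2l //.
    apply: le_trans (qintM q1 _ _); apply: ler_wpM2r => //; exact: qintM.
  by apply: le_trans (qintM q1 _ _) _; apply: le_qint; nat_lia.
have E'le : br a.+1 - K' <= br a.+1 by rewrite lerBlDr lerDl /K'.
move: h1 h2 hL swp E'le; rewrite qint2.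
set x := br (b - t) in xx hx Ke *; set x' := br (a - t) in xx' hx K'e *.
set A0 := N t a; set A1 := N t.+1 a; set A2n := N t.+2 a in A2' *.
set B0 := N t b; set B1 := N t.+1 b; set E' := br a.+1 - K' in E'0 *.
set e := br a.+1; set E := br b.+1 - K in E0 *; set u : rat := q%:R in Ke K'e *.
move=> h1 h2 hL swp E'le; have u2 : 2 <= u := q2.
have B1p : 0 < B1 by rewrite Pnum_gt0.
have B0p : 1 <= B0 by apply: N_ge1 => //; exact: ltnW.
have A0p : 0 <= A0 by apply: p0.
have A1p : 0 < A1 by rewrite Pnum_gt0.
have C2p : 0 <= N t.+2 b by apply: p0.
set D := x * B0 * A1; rewrite -/D in swp.
have Dp : 0 < D by rewrite !mulr_gt0 //; lra.
have xx'0 : 0 < x * x' by rewrite mulr_gt0 //; lra.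
have l1 : (K' * B1 - (K' - 1) * N t.+2 b) * (A0 + E') <= K' * B1 * (A0 + E').
  apply: ler_wpM2r; first by lra.
  have : 0 <= (K' - 1) * N t.+2 b by apply: mulr_ge0 => //; rewrite K'e; nra.
  lra.
have l2 : (K * A1 - A1 / 4) * B0 <= (K * A1 - L) * (B0 + E).
  apply: (@le_trans _ _ ((K * A1 - L) * B0)); first by apply: ler_wpM2r; lra.
  have K1 : 1 <= K by rewrite Ke; nra.
  apply: ler_wpM2l; last by lra.
  by have := ler_wpM2r (ltW A1p) K1; lra.
apply: le_lt_trans l1 (lt_le_trans _ l2).
rewrite -(ltr_pM2r xx'0).
have -> : (K * A1 - A1 / 4) * B0 * (x * x') = (K - 1 / 4) * D * x' by rewrite /D; field.
have -> : K' * B1 * (A0 + E') * (x * x') = K' * x * D + x' * (K' * B1 * E' * x).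
  by rewrite swp; ring.
have l3 : K' * B1 * E' * x <= D / 4.
  have kk : K' <= (u + 1) * x' by rewrite K'e; lra.
  have P : 0 <= B1 * E' * x by rewrite !mulr_ge0 //; lra.
  have := ler_wpM2r P kk.
  have [u10 [x0 x'0]] : 0 <= u + 1 /\ 0 <= x /\ 0 <= x' by lra.
  have P2 : 0 <= (u + 1) * x * (x' * B1) by rewrite !mulr_ge0 // ltW.
  have := ler_wpM2l P2 E'le.
  have P3 : 0 <= x' * B1 by rewrite mulr_ge0 // ltW.
  have := ler_wpM2l P3 h1; lra.
have l4 := ler_wpM2l (_ : 0 <= x') l3; apply: le_lt_trans (lerD (lexx _) (l4 _)) _; first by lra.
have hx2 := ler_wpM2r (ltW Dp) hx; rewrite Ke K'e; lra.
Qed.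

(** For [b < 2 t] one has [br t.+1 >= 2 * br (b.+1 - t) + 1]; this factor 2 absorbs both the 7/8 and
    the extra hyperplanes, at most [N t b / 4]. *)
Lemma C12_lt_C34_small : (b < 2 * t)%N -> C12_upper a b t < C34_size a b t.
Proof.
move=> bt.
apply: (@lt_le_trans _ _ (7 / 8 * (N t.+1 a * (br t.+1 * N t b)))); last exact: C34_ge.
rewrite /C12_upper.
have hE := E_le; have E0 := E_ge0 (ltnW tb).
have hK : 2 * br (b.+1 - t) + 1 <= br t.+1.
  apply: (@le_trans _ _ (br (b.+1 - t).+1)); last by apply: le_qint; nat_lia.
  by rewrite qintS; have := q2; have := b0 (b.+1 - t); nra.
have K1 : 1 <= br (b.+1 - t) by rewrite qint_ge1 // subn_gt0; nat_lia.
have A1p : 0 < N t.+1 a by rewrite Pnum_gt0.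
have A2p := p0 t.+2 a.
have Ele : br b.+1 - br (b.+1 - t) <= br b.+1 by rewrite lerBlDr lerDl.
have B0p : 1 <= N t b by apply: N_ge1 => //; exact: ltnW.
move: K1 hK A1p A2p hE E0 Ele B0p; set K := br (b.+1 - t); set E := _ - K.
set A1 := N t.+1 a; set B0 := N t b; set A2 := N t.+2 a; set tau := br t.+1.
move=> K1 hK A1p A2p hE E0 Ele B0p.
apply: (@le_lt_trans _ _ (K * A1 * (B0 + E))).
  apply: ler_wpM2r; first by lra.
  have : 0 <= (K - 1) * A2 by apply: mulr_ge0 => //; lra.
  lra.
have -> : K * A1 * (B0 + E) = A1 * (K * (B0 + E)) by ring.
have -> : 7 / 8 * (A1 * (tau * B0)) = A1 * (7 / 8 * (tau * B0)) by ring.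
rewrite (ltr_pM2l A1p).
have P : 0 <= B0 by lra.
have h1 : K * E <= K * (B0 / 4) by apply: ler_wpM2l; lra.
have h2 := ler_wpM2r P hK; have h3 := ler_wpM2r P K1; lra.
Qed.

Lemma C12_lt_C34_tie : b = (2 * t)%N -> (1 < t)%N ->
  C12_upper a b t < C34_size a b t.
Proof.
move=> bt t1; rewrite /C12_upper /C34_size.
have -> : (b.+1 - t = t.+1)%N by nat_lia.
have R1b := R1 bnu tb; have R2b := R2 bnu tb; have R2a := R2 anu ta.
have xt : (b - t = t)%N by nat_lia.
have wt : (b - t.+1 = t.-1)%N by nat_lia.
have et : br t.+1 = q%:R * br t + 1 by rewrite qintS.
have et1 : br t = q%:R * br t.-1 + 1 by rewrite -{1}(ltn_predK t1) qintS.
have w1 : 1 <= br t.-1 by rewrite qint_ge1 //; nat_lia.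
have yw : br t.-1 <= br (a - t.+1) by apply: le_qint; nat_lia.
have B2p : 1 <= N t.+2 b by apply: N_ge1 => //; nat_lia.
have A1p : 0 < N t.+1 a by rewrite Pnum_gt0.
have QQ : q%:R ^+ 2 * br (n - 2 * t.+1) <= br (n - 2 * t).
  have -> : (n - 2 * t = (n - 2 * t.+1).+2)%N by nat_lia.
  by rewrite !qintS expr2; have := q2; have := b0 (n - 2 * t.+1); nra.
have Q2big : 4 * (br b.+1 * br t * br t.-1) <= br (n - 2 * t.+1).
  apply: (@le_trans _ _ (br (b.+1 + t + t.-1 + 2))); last by apply: le_qint; nat_lia.
  have -> : 4 = 2 ^+ 2 :> rat by ring.
  apply: le_trans (qint_pow2 q1 _ _); rewrite ler_pM2l //.
  by apply: le_trans (qintM q1 _ _); apply: ler_wpM2r => //; exact: qintM.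
have E0 : 0 <= br b.+1 - br t.+1 by rewrite subr_ge0; apply: le_qint; nat_lia.
have Ele : br b.+1 - br t.+1 <= br b.+1 by rewrite lerBlDr lerDl.
have Q2p : 0 < br (n - 2 * t.+1) by rewrite qint_gt0 //; nat_lia.
rewrite xt in R1b; rewrite wt in R2b; clear xt.
have Qp : 0 < br (n - 2 * t) by rewrite qint_gt0 //; nat_lia.
clear bt wt; have u2 : 2 <= q%:R :> rat := q2; have A2p := p0 t.+2 a; have B0p : 0 < N t b.
  by rewrite Pnum_gt0 // ltnW.
have B1p : 0 < N t.+1 b by rewrite Pnum_gt0.
exact: (tie_arith R1b R2b R2a et et1 w1 yw B2p A1p A2p QQ Q2big E0 Ele Q2p Qp u2 B0p B1p).
Qed.

End Comparisons.

(** * The tie [b = 2 t] at [t = 1], where the exceptional triples arise *)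

Section LinesInPlanes.
Variables (F : finFieldType) (nu a : nat).
Local Notation n := (2 * nu)%N.
Local Notation br := (qint #|F|).
Local Notation N := (Pnum F nu).
Let q1 := card_F_gt1 F.
Hypotheses (a2 : (2 <= a)%N) (hn : (2 * a + 6 <= n)%N).

Let z_relations : [/\ N 1 2 = #|F|%:R ^+ 2 * br (n - 4) + #|F|%:R + 1,
  N 2 a * br (a - 2) = br (n - 4) * N 3 a & br 3 <= br (n - 4)].
Proof.
split; last by apply: le_qint; lia.
  have := @PnumS F nu 1 2; rewrite qint1 mulr1 Pnum_id mulr1 => ->; last lia.
  have -> : (n - 2 * 1 = (n - 4).+2)%N by lia.
  by rewrite !qintS; ring.
by rewrite PnumS //; lia.
Qed.

(** Without the common term [(q + 1) * N 1 2 * N 2 a], the loss of [C1] is about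
    [q ^ 3 * br (a - 2)] against [q ^ 3 + q ^ 2 + q] on the other side, in units of [N 2 a]. The
    bracket is 0 for [a = 2] and 1 for [a = 3], so ([C1], [C2]) wins. *)
Lemma C34_lt_C12_planes : (a <= 3)%N -> C34_size F nu a 2 1 < C12_lower F nu a 2 1.
Proof.
move=> a3; have [eZ eA zb] := z_relations; have q2 := qR_ge2 q1.
rewrite /C34_size /C12_lower /= Pnum_id eZ.
have br3 : br 3 = #|F|%:R * (#|F|%:R + 1) + 1 by rewrite qintS qint2.
rewrite (_ : (3 - 1 = 2)%N) // qint2 br3; rewrite br3 in zb.
have c0 : 0 < #|F|%:R + 1 :> rat by lra.
move: eA zb q2 c0; set z := br (n - 4); set u : rat := #|F|%:R.
have [e|e] : a = 2%N \/ a = 3%N by lia.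
  rewrite e Pnum_id (Pnum_eq0 _ _ (ltnSn 2)) => _ zb q2 c0.
  rewrite mulr0 subr0 mul1r; have := mulr_gt0 c0 c0; nra.
rewrite e qint1 mulr1 => -> zb q2 c0; rewrite Pnum_id.
have c1 : u + 1 != 0 by rewrite gt_eqF.
have -> : (u + 1) * (u + 1 - 1) / (u + 1) = u by field.
have u0 : 0 < u by lra.
have h := ler_wpM2l (ltW (mulr_gt0 u0 c0)) zb.
have : 0 < u * u * (u * (u + 1) + 1) by rewrite !mulr_gt0 // addr_gt0 // mulr_gt0.
lra.
Qed.

(** From [a = 4] on, [br (a - 2) >= q + 1], and the loss of [C1] prevails. *)
Lemma C12_lt_C34_planes : (4 <= a)%N -> (a <= nu)%N ->
  C12_upper F nu a 2 1 < C34_size F nu a 2 1.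
Proof.
move=> a4 anu; have [eZ eA zb] := z_relations; have q2 := qR_ge2 q1.
have A1p : 0 < N 2 a by rewrite Pnum_gt0.
have A2p := Pnum_ge0 F nu 3 a.
have yy : br 2 <= br (a - 2) by apply: le_qint; lia.
have z0 := qint_ge0 #|F| (n - 4).
rewrite /C34_size /C12_upper /= Pnum_id eZ.
have br3 : br 3 = #|F|%:R * (#|F|%:R + 1) + 1 by rewrite qintS qint2.
rewrite (_ : (3 - 1 = 2)%N) // qint2 br3; rewrite qint2 in yy.
move: eA zb q2 A1p A2p yy z0; set z := br (n - 4); set u : rat := #|F|%:R.
set A1 := N 2 a; set A2 := N 3 a; set y := br (a - 2) => eA _ q2 A1p A2p yy z0.
have h1 : A1 * (u + 1) <= z * A2 by rewrite -eA ler_pM2l.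
have u0 : 0 < u by lra.
have h2 := ler_wpM2l (ltW (mulr_gt0 (mulr_gt0 u0 u0) u0)) h1.
have h3 : 0 <= u * A2 * (u * (u + 1) + 1).
  by rewrite !mulr_ge0 // ?addr_ge0 ?mulr_ge0 //; lra.
have h4 : 2 * (u * u * (u + 1) * A1) <= u * (u * u * (u + 1) * A1).
  by apply: ler_wpM2r => //; rewrite !mulr_ge0 //; lra.
have h5 : u * A1 < u * u * (u + 1) * A1 by rewrite ltr_pM2r //; nra.
lra.
Qed.

End LinesInPlanes.

Lemma subset_prod_eq (T : finType) (X Y A B : {set T}) :
  X \subset A -> Y \subset B -> (0 < #|X| * #|Y|)%N ->
  (#|A| * #|B| <= #|X| * #|Y|)%N -> X = A /\ Y = B.
Proof.
move=> XA YB; rewrite muln_gt0 => /andP[x0 y0] le.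
have cX := subset_leq_card XA; have cY := subset_leq_card YB.
split; apply/eqP; rewrite eqEcard ?XA ?YB /=.
  rewrite -(leq_pmul2r y0); apply: leq_trans le; exact: leq_mul.
rewrite -(leq_pmul2l x0); apply: leq_trans le; exact: leq_mul.
Qed.

(** * Reduction to four structures and choice of the largest *)

Section Optimum.
Variables (F : finFieldType) (nu : nat) (J : 'M[F]_(2 * nu)).
Hypothesis HJ : nondeg_alt J.
Local Notation n := (2 * nu)%N.
Local Notation sub := 'M[F]_n.
Local Notation br := (qint #|F|).
Local Notation N := (Pnum F nu).
Let q1 := card_F_gt1 F.

Lemma card_C12 (M T : sub) a b t : M \in Pm J b.+1 -> T \in subs_of M t ->
  (t < b)%N -> (t < a)%N ->
  C12_lower F nu a b t <= (#|C1 J M T a t| * #|C2 J M T b|)%:R <= C12_upper F nu a b t.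
Proof.
move=> MP TM tb ta; rewrite natrM (card_C2 HJ MP TM) /C12_lower /C12_upper.
have E0 : 0 <= N t b + (br b.+1 - br (b.+1 - t)).
  by rewrite addr_ge0 ?Pnum_ge0 // subr_ge0; apply: le_qint; exact: leq_subr.
apply/andP; split; apply: ler_wpM2r => //.
  exact: C1_lower.
exact: C1_upper.
Qed.

Lemma card_C34 (S : sub) a b t : S \in Pm J t.+1 ->
  (#|C3 J S a| * #|C4 J S b t|)%:R = C34_size F nu a b t.
Proof. by move=> SP; rewrite natrM (card_C3 HJ a SP) (card_C4 HJ b SP). Qed.

Lemma Pm_exists m : (m <= nu)%N -> exists S, S \in Pm J m.
Proof.
move=> mn; have i0 : tot_iso J 0 by apply/tot_isoP; rewrite !mul0mx.
have [|S SP _] := Pm_ext_exists HJ i0 (m := m) _ mn; first by rewrite mxrank0.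
by exists S.
Qed.

Lemma flag_exists b t : (t <= b)%N -> (b < nu)%N ->
  exists M T, M \in Pm J b.+1 /\ T \in subs_of M t.
Proof.
move=> tb bn; have [M MP] := Pm_exists bn; have /PmP[_ rM _] := MP.
have [|T [_ TM rT]] := between_exists (r := t) (sub0mx _ M).
  by rewrite mxrank0 rM; exact: leqW.
exists M, <<T>>%MS; split=> //.
by rewrite inE genmx_subspace !genmxE rT eqxx.
Qed.

Lemma C12_nontrivial (M T : sub) a b t : (0 < t)%N -> M \in Pm J b.+1 ->
  ~ trivial_fam J t (C1 J M T a t) (C2 J M T b).
Proof.
move=> t0 /PmP[_ rM _] [T0 /PmP[_ rT _] h].
apply: (@C2_no_common _ _ J M T T0 b rM); first by rewrite rT.
by move=> A AM; apply: h; rewrite in_setU AM orbT.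
Qed.

Lemma C34_nontrivial (S : sub) a b t : (0 < t)%N -> (t < b)%N -> (b <= nu)%N ->
  S \in Pm J t.+1 -> ~ trivial_fam J t (C3 J S a) (C4 J S b t).
Proof.
move=> t0 tb bn SP [T0 TP h]; apply: (C4_no_common HJ SP TP t0 tb bn).
by move=> A AM; apply: h; rewrite in_setU AM orbT.
Qed.

Lemma structure_cases (X Y : {set sub}) a b t :
  (b <= a)%N -> (0 < t)%N -> (t < b)%N -> (2 * a + b + t + 3 <= n)%N ->
  X \subset Pm J a -> Y \subset Pm J b ->
  cross_int t X Y -> ~ trivial_fam J t X Y -> X != set0 -> Y != set0 ->
  3 * (br (b - t) * N t.+1 a * N t b) < 2 * (#|X|%:R * #|Y|%:R) ->
  [\/ exists M T, [/\ M \in Pm J b.+1, T \in subs_of M t,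
        X \subset C1 J M T a t & Y \subset C2 J M T b],
      exists S, [/\ S \in Pm J t.+1, X \subset C3 J S a & Y \subset C4 J S b t],
      exists M T, [/\ M \in Pm J a.+1, T \in subs_of M t,
        Y \subset C1 J M T b t & X \subset C2 J M T a]
    | exists S, [/\ S \in Pm J t.+1, Y \subset C3 J S b & X \subset C4 J S a t]].
Proof.
move=> ba t0 tb hn XP YP cXY nontriv X0 Y0 big.
have ta : (t < a)%N := leq_trans tb ba.
have hn1 : (a + b + maxn a b + t + 3 <= n)%N by nat_lia.
have hn2 : (b + a + maxn b a + t + 3 <= n)%N by nat_lia.
have bnu : (t < nu)%N by nat_lia.
have cYX : cross_int t Y X by move=> A B AY BX; rewrite capmxC cXY.
case: (boolP [exists T in Pm J t, [forall A in X, (T <= A)%MS]]).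
  move=> /exists_inP[T TP /forall_inP TX].
  have nY : exists2 G, G \in Y & ~~ (T <= G)%MS.
    apply/exists_inP; apply: contraT; rewrite negb_exists_in => /forall_inP TY.
    case: nontriv; exists T => // A; rewrite in_setU => /orP[/TX //|/TY].
    by rewrite negbK.
  have [h|h|h] := common_subspace_cases HJ hn1 t0 ta tb XP YP cXY X0 TP TX nY.
  - exact: Or41.
  - exact: Or42.
  - by have := le_lt_trans h big; rewrite ltxx.
move=> /exists_inPn nX.
case: (boolP [exists T in Pm J t, [forall A in Y, (T <= A)%MS]]).
  move=> /exists_inP[T TP /forall_inP TY].
  have nX' : exists2 G, G \in X & ~~ (T <= G)%MS.
    by apply/exists_inP; rewrite -negb_forall_in; apply: nX.
  have [h|h|h] := common_subspace_cases HJ hn2 t0 tb ta YP XP cYX Y0 TP TY nX'.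
  - exact: Or43.
  - exact: Or44.
  (* The bound arrives with the roles exchanged; [Pnum_swap] shows that D is the same in both
     orders. *)
  - have := Pnum_swap F ba t0 tb hn; lra.
move=> /exists_inPn nY.
have := cross_bound_no_common HJ _ _ _ (ltnW ta) (ltnW tb) XP YP cXY X0 Y0.
have e := @PnumS F nu t b bnu.
move=> h; have {}h : #|X|%:R * #|Y|%:R <= br (n - 2 * t) * N t.+1 a * N t.+1 b.
  apply: h; try nat_lia.
    by move=> T /nX; rewrite negb_forall_in => /exists_inP.
  by move=> T /nY; rewrite negb_forall_in => /exists_inP.
have D0 : 0 <= N t.+1 a * (N t b * br (b - t)).
  by rewrite !mulr_ge0 ?Pnum_ge0 ?qint_ge0.
have := congr1 (fun z => N t.+1 a * z) e; lra.
Qed.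

End Optimum.

Theorem theorem1p2 (F : finFieldType) (nu m1 m2 t : nat)
  (J : 'M[F]_(2 * nu)) (HJ : nondeg_alt J)
  (F1 F2 : {set 'M[F]_(2 * nu)}) :
  (0 < nu)%N -> (0 < m1)%N -> (0 < m2)%N -> (0 < t)%N ->
  (m2 <= m1)%N -> (t.+1 <= m2)%N ->
  (2 * m1 + m2 + t + 3 <= 2 * nu)%N ->
  F1 \subset Pm J m1 -> F2 \subset Pm J m2 ->
  cross_int t F1 F2 -> ~ trivial_fam J t F1 F2 ->
  (forall G1 G2 : {set 'M[F]_(2 * nu)},
     G1 \subset Pm J m1 -> G2 \subset Pm J m2 ->
     cross_int t G1 G2 -> ~ trivial_fam J t G1 G2 ->
     (#|G1| * #|G2| <= #|F1| * #|F2|)%N) ->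
  let exc := ((m1, m2, t) == (2, 2, 1)%N) || ((m1, m2, t) == (3, 2, 1)%N) in
  ((2 * t < m2)%N || exc ->
     exists M T,
       [/\ M \in Pm J m2.+1, T \in subs_of M t &
         (F1 = C1 J M T m1 t /\ F2 = C2 J M T m2) \/
         [/\ m1 = m2, F1 = C2 J M T m1 & F2 = C1 J M T m2 t]])
  /\
  ((m2 <= 2 * t)%N && ~~ exc ->
     exists S,
       S \in Pm J t.+1 /\
       ((F1 = C3 J S m1 /\ F2 = C4 J S m2 t) \/
        [/\ m1 = m2, F1 = C4 J S m1 t & F2 = C3 J S m2])).
Proof.
move=> _ _ _ t0 m21 tm2 hn F1P F2P cF nontriv opt exc.
have tm1 : (t < m1)%N := leq_trans tm2 m21.
have m1nu : (m1 < nu)%N by nat_lia.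
have m2nu : (m2 < nu)%N := leq_ltn_trans m21 m1nu.
pose W := (#|F1| * #|F2|)%N.
have opt12 (M T : 'M[F]_(2 * nu)) : M \in Pm J m2.+1 -> T \in subs_of M t ->
    (#|C1 J M T m1 t| * #|C2 J M T m2| <= W)%N.
  move=> MP TM; have /PmP[_ rM iM] := MP; apply: opt.
  - exact: C1_Pm.
  - exact: C2_Pm.
  - by apply: C1_C2_cross => //; move: TM; rewrite inE => /and3P[_ /eqP].
  - exact: C12_nontrivial.
have opt34 (S : 'M[F]_(2 * nu)) : S \in Pm J t.+1 ->
    (#|C3 J S m1| * #|C4 J S m2 t| <= W)%N.
  move=> SP; apply: opt.
  - exact: C3_Pm.
  - exact: C4_Pm.
  - exact: C3_C4_cross.
  - by apply: C34_nontrivial => //; exact: ltnW.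
have low12 : C12_lower F nu m1 m2 t <= W%:R.
  have [M [T [MP TM]]] := flag_exists HJ (ltnW tm2) m2nu.
  have /andP[le _] := card_C12 HJ MP TM tm2 tm1.
  by apply: le_trans le _; rewrite ler_nat opt12.
have low34 : C34_size F nu m1 m2 t <= W%:R.
  have [S SP] := Pm_exists HJ (ltn_trans tm1 m1nu).
  by rewrite -(card_C34 HJ _ _ SP) ler_nat opt34.
have big := C12_lower_gt F m21 t0 tm2 hn.
(* Non-triviality does not by itself exclude an empty family; positivity comes from the concrete
   pair ([C1], [C2]). *)
have W0 : (0 < W)%N.
  rewrite -(ltr0n rat); apply: lt_le_trans low12.
  have : 0 <= qint #|F| (m2 - t) * Pnum F nu t.+1 m1 * Pnum F nu t m2.
    by rewrite !mulr_ge0 ?qint_ge0 ?Pnum_ge0.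
  lra.
have [F10 F20] : F1 != set0 /\ F2 != set0.
  by move: W0; rewrite /W muln_gt0 !card_gt0 => /andP.
have bigW : 3 * (qint #|F| (m2 - t) * Pnum F nu t.+1 m1 * Pnum F nu t m2)
    < 2 * (#|F1|%:R * #|F2|%:R).
  by rewrite -natrM -/W; apply: lt_le_trans big _; rewrite ler_pM2l.
have up12 (X Y : {set 'M[F]_(2 * nu)}) (M T : 'M[F]_(2 * nu)) a b :
    (t < a)%N -> (t < b)%N -> M \in Pm J b.+1 -> T \in subs_of M t ->
    X \subset C1 J M T a t -> Y \subset C2 J M T b ->
    (#|X| * #|Y|)%:R <= C12_upper F nu a b t.
  move=> ta tb MP TM XC YC; have /andP[_ le] := card_C12 HJ MP TM tb ta.
  by apply: le_trans le; rewrite ler_nat leq_mul // subset_leq_card.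
have up34 (X Y : {set 'M[F]_(2 * nu)}) (S : 'M[F]_(2 * nu)) a b :
    S \in Pm J t.+1 -> X \subset C3 J S a -> Y \subset C4 J S b t ->
    (#|X| * #|Y|)%:R <= C34_size F nu a b t.
  move=> SP XC YC; rewrite -(card_C34 HJ _ _ SP).
  by rewrite ler_nat leq_mul // subset_leq_card.
have WC : (#|F2| * #|F1|)%N = W by rewrite mulnC.
have cases := structure_cases HJ m21 t0 tm2 hn F1P F2P cF nontriv F10 F20 bigW.
split=> [hyp|/andP[m2t nexc]].
  have lt : C34_size F nu m1 m2 t < C12_lower F nu m1 m2 t.
    case/orP: hyp => [tm|]; first exact: C34_lt_C12_large.
    rewrite /exc !xpair_eqE => h.
    have [e2 [e1 le]] : m2 = 2%N /\ t = 1%N /\ (m1 <= 3)%N.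
      by case/orP: h => /andP[/andP[/eqP -> /eqP ->] /eqP ->].
    move: hn m21; rewrite e2 e1 => hn' m21'.
    by apply: C34_lt_C12_planes => //; nat_lia.
  have no (X Y : {set 'M[F]_(2 * nu)}) (S : 'M[F]_(2 * nu)) a b :
      (#|X| * #|Y|)%N = W -> C34_size F nu a b t <= C34_size F nu m1 m2 t ->
      S \in Pm J t.+1 -> X \subset C3 J S a -> Y \subset C4 J S b t -> False.
    move=> eW le SP XC YC; have := up34 _ _ _ _ _ SP XC YC; rewrite eW => up.
    have := le_lt_trans (le_trans up le) (lt_le_trans lt low12).
    by rewrite ltxx.
  (* Containment in the winning pair becomes equality by maximality; any other structure would keep
     the product below the winner. An exchanged winner survives only for [m1 = m2]. *)
  case: cases => [[M [T [MP TM XC YC]]]|[S [SP XC YC]]|[M [T [MP TM XC YC]]]|[S [SP XC YC]]].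
  - exists M, T; split=> //; left.
    by apply: subset_prod_eq => //; exact: opt12.
  - by case: (no F1 F2 S m1 m2).
  - have [e|ne] := eqVneq m1 m2.
      subst m2; exists M, T; split=> //; right; split=> //.
        by have [] := subset_prod_eq XC YC _ _ => //; rewrite WC // opt12.
      by have [] := subset_prod_eq XC YC _ _ => //; rewrite WC // opt12.
    have ltm : (m2 < m1)%N by rewrite ltn_neqAle eq_sym ne.
    have := up12 _ _ _ _ _ _ tm2 tm1 MP TM XC YC; rewrite WC => up.
    have := le_lt_trans up (lt_le_trans (C12_lt_C12 F m21 t0 tm2 hn ltm) low12).
    by rewrite ltxx.
  (* The exchanged ([C3], [C4]) pair is no larger than the original one, hence also below ([C1],
     [C2]). *)
  - case: (no F2 F1 S m2 m1) => //; have [->|ne] := eqVneq m1 m2; first exact: lexx.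
    apply/ltW/C34_lt_C34 => //.
    by rewrite ltn_neqAle eq_sym ne.
have lt : C12_upper F nu m1 m2 t < C34_size F nu m1 m2 t.
  have [lt|ge] := ltnP m2 (2 * t); first exact: C12_lt_C34_small.
  have e : m2 = (2 * t)%N by apply/eqP; rewrite eqn_leq m2t.
  have [t1|t1] := ltnP 1 t; first exact: C12_lt_C34_tie.
  have e1 : t = 1%N by apply/eqP; rewrite eqn_leq t1.
  move: e nexc; rewrite /exc e1 => e2; rewrite e2 !xpair_eqE !eqxx !andbT => ne.
  move: hn m21; rewrite e2 e1 => hn' m21'.
  have m4 : (4 <= m1)%N by move: ne m21'; case: (m1) => [|[|[|[|m]]]].
  by apply: C12_lt_C34_planes => //; nat_lia.
case: cases => [[M [T [MP TM XC YC]]]|[S [SP XC YC]]|[M [T [MP TM XC YC]]]|[S [SP XC YC]]].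
- have up := up12 _ _ _ _ _ _ tm1 tm2 MP TM XC YC.
  by have := le_lt_trans up (lt_le_trans lt low34); rewrite ltxx.
- exists S; split=> //; left.
  by apply: subset_prod_eq => //; exact: opt34.
- have := up12 _ _ _ _ _ _ tm2 tm1 MP TM XC YC; rewrite WC => up.
  have [e|ne] := eqVneq m1 m2.
    subst m2; have := le_lt_trans up (lt_le_trans lt low34).
    by rewrite ltxx.
  have ltm : (m2 < m1)%N by rewrite ltn_neqAle eq_sym ne.
  (* For [m1 > m2] the exchanged ([C1], [C2]) pair already loses to the unexchanged one, which the
     maximum dominates. *)
  have := le_lt_trans up (lt_le_trans (C12_lt_C12 F m21 t0 tm2 hn ltm) low12).
  by rewrite ltxx.
- exists S; split=> //; right.
  have := up34 _ _ _ _ _ SP XC YC; rewrite WC => up.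
  have [e|ne] := eqVneq m1 m2.
    subst m2; have [] := subset_prod_eq XC YC _ _ => //; rewrite WC //.
    by rewrite opt34.
  have ltm : (m2 < m1)%N by rewrite ltn_neqAle eq_sym ne.
  have := le_lt_trans up (lt_le_trans (C34_lt_C34 F m21 t0 tm2 hn ltm) low34).
  by rewrite ltxx.
Qed.
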